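(* Every Schnorr random real $x\in[0,1]$ is strongly UD-random: for every computable sequence $(u_n)_{n\in\mathbb{N}}$ of rationals for which there is $k>0$ with $|u_i-u_j|>k$ for all $i\ne j$, the sequence $(u_nx)_{n\in\mathbb{N}}$ is uniformly distributed modulo one.
   Context: For a real $y$, $\mathrm{frac}(y)=y-\lfloor y\rfloor$. A sequence $(y_n)$ of reals is uniformly distributed modulo one if for every interval $[u,v]\subseteq[0,1]$, the proportion of $j<N$ with $\mathrm{frac}(y_j)\in[u,v]$ tends to $v-u$ as $N\to\infty$. Schnorr randomness is with respect to Lebesgue measure on $[0,1]$; equivalently, $x$ is Schnorr random iff it belongs to only finitely many $A_n$ for every total Solovay test, i.e. every uniformly $\Sigma^0_1$ sequence of sets $(A_n)$ such that $\sum_n\lambda A_n$ is finite and a computable real. *)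

(* Defs.v *)
From Stdlib Require Import Reals Lra List QArith Qreals Cantor.
Import ListNotations.
Open Scope R_scope.

Inductive prf : Type :=
| PZero : prf
| PSucc : prf
| PProj : nat -> prf
| PComp : prf -> list prf -> prf
| PPrim : prf -> prf -> prf
| PMu   : prf -> prf.

Inductive prf_eval : prf -> list nat -> nat -> Prop :=
| ev_zero l : prf_eval PZero l 0
| ev_succ l : prf_eval PSucc l (S (hd 0%nat l))
| ev_proj i l : prf_eval (PProj i) l (nth i l 0%nat)
| ev_comp f gs l ys y :
    prf_evals gs l ys -> prf_eval f ys y -> prf_eval (PComp f gs) l y
| ev_prim0 f g rest y :
    prf_eval f rest y -> prf_eval (PPrim f g) (0%nat :: rest) y
| ev_primS f g n rest z y :
    prf_eval (PPrim f g) (n :: rest) z ->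
    prf_eval g (n :: z :: rest) y ->
    prf_eval (PPrim f g) (S n :: rest) y
| ev_mu f l n :
    prf_eval f (n :: l) 0%nat ->
    (forall m, (m < n)%nat -> exists k, prf_eval f (m :: l) (S k)) ->
    prf_eval (PMu f) l n
with prf_evals : list prf -> list nat -> list nat -> Prop :=
| evs_nil l : prf_evals [] l []
| evs_cons g gs l y ys :
    prf_eval g l y -> prf_evals gs l ys -> prf_evals (g :: gs) l (y :: ys).

Definition computable1 (f : nat -> nat) : Prop :=
  exists c : prf, forall n, prf_eval c [n] (f n).
Definition computable2 (f : nat -> nat -> nat) : Prop :=
  exists c : prf, forall n m, prf_eval c [n; m] (f n m).

Definition Z_of_code (n : nat) : Z :=
  if Nat.even n then Z.of_nat (Nat.div2 n) else (- Z.of_nat (S (Nat.div2 n)))%Z.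
Definition Q_of_code (n : nat) : Q :=
  let '(a, b) := Cantor.of_nat n in Qmake (Z_of_code a) (Pos.of_succ_nat b).
Definition R_of_code (n : nat) : R := Q2R (Q_of_code n).
Definition RR_of_code (n : nat) : R * R :=
  let '(a, b) := Cantor.of_nat n in (R_of_code a, R_of_code b).

Definition computable_Q_seq (u : nat -> Q) : Prop :=
  exists f, computable1 f /\ forall n, u n = Q_of_code (f n).

Definition computable_real (s : R) : Prop :=
  exists f, computable1 f /\ forall n, Rabs (R_of_code (f n) - s) <= / 2 ^ n.

Fixpoint pairwise_disjoint (l : list (R * R)) : Prop :=
  match l with
  | [] => True
  | (c, d) :: l' =>
      Forall (fun p => d <= fst p \/ snd p <= c) l' /\ pairwise_disjoint l'
  end.

Definition total_length (l : list (R * R)) : R :=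
  fold_right (fun p acc => (snd p - fst p) + acc) 0 l.

Definition inner_lengths (S : R -> Prop) (t : R) : Prop :=
  exists l : list (R * R),
    Forall (fun p => fst p < snd p /\
                     forall y, fst p < y < snd p -> S y) l /\
    pairwise_disjoint l /\ t = total_length l.

(* measure_is S m : S (an open subset of [0,1], up to endpoints) has
   Lebesgue measure m *)
Definition measure_is (S : R -> Prop) (m : R) : Prop :=
  is_lub (inner_lengths S) m.

Definition sigma01_seq_of (g : nat -> nat -> nat) (n : nat) (x : R) : Prop :=
  0 <= x <= 1 /\
  exists m, fst (RR_of_code (g n m)) < x < snd (RR_of_code (g n m)).

Definition unif_sigma01_seq (A : nat -> R -> Prop) : Prop :=
  exists g, computable2 g /\ forall n x, A n x <-> sigma01_seq_of g n x.

Definition total_solovay_test (A : nat -> R -> Prop) : Prop :=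
  unif_sigma01_seq A /\
  exists mu : nat -> R,
    (forall n, measure_is (A n) (mu n)) /\
    exists s, infinite_sum mu s /\ computable_real s.

Definition schnorr_random (x : R) : Prop :=
  forall A, total_solovay_test A -> exists N, forall n, (N <= n)%nat -> ~ A n x.

Definition in_interval_b (u v y : R) : nat :=
  if Rle_dec u y then if Rle_dec y v then 1%nat else 0%nat else 0%nat.

Fixpoint count_in (y : nat -> R) (u v : R) (N : nat) : nat :=
  match N with
  | O => O
  | S N' => (count_in y u v N' + in_interval_b u v (frac_part (y N')))%nat
  end.

Definition ud_mod_one (y : nat -> R) : Prop :=
  forall u v, 0 <= u -> u <= v -> v <= 1 ->
    Un_cv (fun N => INR (count_in y u v N) / INR N) (v - u).

Definition strongly_UD_random (x : R) : Prop :=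
  forall u : nat -> Q,
    computable_Q_seq u ->
    (exists k, k > 0 /\ forall i j, i <> j -> Rabs (Q2R (u i) - Q2R (u j)) > k) ->
    ud_mod_one (fun n => Q2R (u n) * x).

(* Main.v *)
Require Import Defs.
From Stdlib Require Import Reals QArith Qreals.
From Stdlib Require Import List Arith ZArith Lia Lra Cantor Bool.
Import ListNotations.

(** Contrapositive of Weyl's criterion, made quantitative. If an arc is hit by
    [u_i x], [i < N], noticeably more often than its length predicts, then, majorizing
    its indicator by Fejer kernels, one of boundedly many exponential sums
    [sum_(i<N) e(h u_i x)] has modulus at least a constant times [N]. As the [u_i] are
    separated, the integral over [x] of the squared modulus of this sum is
    [O(N^(3/2))], so along [N = (C (m+1))^4] the exceptional set has measure
    [O((m+1)^-2)]. Whether the arc is hit too often is tested at the points of a rational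
    grid so fine that the answer hardly depends on the point within a cell; this makes the
    exceptional set a finite union of cells computable from [m]. Adding further cells
    raises its measure to exactly [1 / ((m+1)(m+2))], whence a total Solovay test of
    measure sum 1. Fourth powers are dense enough to pass to all [N], and lower bounds on
    hits follow from upper bounds on the complementary arcs. *)

(** * Computable functions *)

Open Scope nat_scope.

(** The mean square [O(N^(3/2))] is not sharp, but it needs only a packing argument: frequencies
    within [sqrt N] of a given one are counted, and the others give integrals of at most
    [1 / sqrt N]. Against the threshold of order [N^2] this leaves measure of order [N^(-1/2)],
    which along fourth powers is summable. The analytic constants (the separation [k], the number of
    Fejer frequencies, the threshold factor) need not be computable, since they enter the test only
    through the single natural number [C]. The shaping obstacle is effectivity: hits at a real point
    cannot be decided, whereas at a rational point they reduce to integer arithmetic. Each passage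
    between a point and the sample point of its cell costs a margin of [1/L] on either side of the
    arc, and all these margins are paid out of the final [eps]. *)

Definition computable_on (k : nat) (F : list nat -> nat) : Prop :=
  exists c : prf, forall l, length l = k -> prf_eval c l (F l).

Fixpoint nsum (n : nat) (f : nat -> nat) : nat :=
  match n with O => O | S m => (nsum m f + f m)%nat end.

Lemma computable_on_ext k F G :
  (forall l, length l = k -> F l = G l) -> computable_on k G -> computable_on k F.
Proof.
  intros E [c Hc]; exists c; intros l Hl; rewrite (E l Hl); auto.
Qed.

(** The offset [l0] makes the induction go through. With [l0] empty the projections copy an argument
    list; with two entries they drop the counter and the accumulator of a recursion. *)
Lemma prf_evals_proj l : forall l0,
  prf_evals (map PProj (seq (length l0) (length l))) (l0 ++ l) l.
Proof.
  induction l as [|a l IH]; intros l0; simpl; constructor.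
  - replace a with (nth (length l0) (l0 ++ a :: l) 0) at 2.
    + constructor.
    + rewrite app_nth2, Nat.sub_diag; auto.
  - specialize (IH (l0 ++ [a])).
    rewrite length_app, <- app_assoc in IH; simpl in IH.
    rewrite Nat.add_1_r in IH; exact IH.
Qed.

Lemma computable_on_var k i : computable_on k (fun l => nth i l 0).
Proof. exists (PProj i); intros; constructor. Qed.

Lemma computable_on_var1 k i : computable_on k (fun l => nth i (tl l) 0).
Proof.
  apply computable_on_ext with (fun l => nth (S i) l 0); [|apply computable_on_var].
  intros [|a l] _; simpl; auto; destruct i; auto.
Qed.

Lemma computable_on_var2 k i : computable_on k (fun l => nth i (tl (tl l)) 0).
Proof.
  apply computable_on_ext with (fun l => nth (S i) (tl l) 0);
    [|apply computable_on_var1].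
  intros l _; destruct (tl l); simpl; auto; destruct i; auto.
Qed.

Lemma computable_on_comp1 k f E :
  computable1 f -> computable_on k E -> computable_on k (fun l => f (E l)).
Proof.
  intros [c Hc] [e He]; exists (PComp c [e]); intros l Hl.
  econstructor; [|apply Hc]. repeat constructor; auto.
Qed.

Lemma computable_on_comp2 k f E1 E2 :
  computable2 f -> computable_on k E1 -> computable_on k E2 ->
  computable_on k (fun l => f (E1 l) (E2 l)).
Proof.
  intros [c Hc] [e He] [e' He']; exists (PComp c [e; e']); intros l Hl.
  econstructor; [|apply Hc]. repeat constructor; auto.
Qed.

Lemma computable1_of f : computable_on 1 (fun l => f (nth 0 l 0)) -> computable1 f.
Proof. intros [c Hc]; exists c; intros n; apply (Hc [n]); reflexivity. Qed.

Lemma computable2_of f :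
  computable_on 2 (fun l => f (nth 0 l 0) (nth 1 l 0)) -> computable2 f.
Proof. intros [c Hc]; exists c; intros n m; apply (Hc [n; m]); reflexivity. Qed.

(** The arity [k] is fixed because the program must list the [k] projections that pass the
    parameters on behind the recursion counter. *)
Lemma computable_on_rec k F G H :
  computable_on k F ->
  computable_on (S (S k)) (fun l => G (nth 0 l 0) (nth 1 l 0) (tl (tl l))) ->
  computable_on k H ->
  computable_on k
    (fun l => nat_rect (fun _ => nat) (F l) (fun n z => G n z l) (H l)).
Proof.
  intros [f Hf] [g Hg] [h Hh].
  exists (PComp (PPrim f g) (h :: map PProj (seq 0 k))); intros l Hl.
  apply ev_comp with (H l :: l).
  - constructor; auto. rewrite <- Hl. exact (prf_evals_proj l []).
  - induction (H l) as [|n IH]; simpl.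
    + constructor; auto.
    + econstructor; [exact IH|].
      refine (Hg (n :: _ :: l) _). simpl; auto.
Qed.

Lemma computable_on_const k n : computable_on k (fun _ => n).
Proof.
  induction n as [|n [c Hc]].
  - exists PZero; intros; constructor.
  - exists (PComp PSucc [c]); intros l Hl.
    apply ev_comp with [n]; [repeat constructor; auto|apply (ev_succ [n])].
Qed.

Lemma computable1_S : computable1 S.
Proof. exists PSucc; intros n; apply (ev_succ [n]). Qed.

Lemma computable1_pred : computable1 Nat.pred.
Proof.
  apply computable1_of.
  apply computable_on_ext with (fun l => nat_rect (fun _ => nat) 0
    (fun n z => n) (nth 0 l 0)).
  - intros l _; destruct (nth 0 l 0); auto.
  - apply (computable_on_rec 1 (fun _ => 0) (fun n z l => n));
      auto using computable_on_const, computable_on_var.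
Qed.

Lemma computable2_add : computable2 Nat.add.
Proof.
  apply computable2_of.
  apply computable_on_ext with (fun l => nat_rect (fun _ => nat) (nth 0 l 0)
    (fun n z => S z) (nth 1 l 0)).
  - intros l _; induction (nth 1 l 0); simpl; lia.
  - apply (computable_on_rec 2 (fun l => nth 0 l 0) (fun n z l => S z));
      auto using computable_on_const, computable_on_var, computable_on_comp1, computable1_S.
Qed.

Lemma computable2_sub : computable2 Nat.sub.
Proof.
  apply computable2_of.
  apply computable_on_ext with (fun l => nat_rect (fun _ => nat) (nth 0 l 0)
    (fun n z => Nat.pred z) (nth 1 l 0)).
  - intros l _; induction (nth 1 l 0); simpl; lia.
  - apply (computable_on_rec 2 (fun l => nth 0 l 0) (fun n z l => Nat.pred z));
      auto using computable_on_const, computable_on_var, computable_on_comp1, computable1_pred.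
Qed.

(** Bounded sums replace bounded search below: a threshold is found by counting the indices beneath
    it, and existence is positivity of a sum. *)
Lemma computable_on_sum k B F :
  computable_on k B ->
  computable_on (S k) (fun l => F (nth 0 l 0) (tl l)) ->
  computable_on k (fun l => nsum (B l) (fun i => F i l)).
Proof.
  intros HB [f Hf].
  apply computable_on_ext with (fun l => nat_rect (fun _ => nat) 0
    (fun n z => (z + F n l)%nat) (B l)).
  - intros l _; induction (B l); simpl; lia.
  - apply (computable_on_rec k (fun _ => 0) (fun n z l => (z + F n l)%nat));
      auto using computable_on_const.
    apply (computable_on_comp2 _ Nat.add); auto using computable2_add, computable_on_var.
    (* Skipping position 1 hides the accumulator from the summand. *)
    exists (PComp f (PProj 0 :: map PProj (seq 2 k))).
    intros [|a [|b l]]; simpl; try discriminate; intros Hl; injection Hl as Hl.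
    apply ev_comp with (a :: l).
    + constructor; [apply (ev_proj 0)|].
      rewrite <- Hl. exact (prf_evals_proj l [a; b]).
    + refine (Hf (a :: l) _). simpl; auto.
Qed.

Lemma computable2_mul : computable2 Nat.mul.
Proof.
  apply computable2_of.
  apply computable_on_ext with (fun l => nsum (nth 1 l 0) (fun _ => nth 0 l 0)).
  - intros l _; induction (nth 1 l 0); simpl; lia.
  - apply (computable_on_sum 2 (fun l => nth 1 l 0) (fun _ l => nth 0 l 0));
      auto using computable_on_var, computable_on_var1.
Qed.

Lemma computable2_leb : computable2 (fun a b => Nat.b2n (a <=? b)).
Proof.
  apply computable2_of.
  apply computable_on_ext with (fun l => (1 - (nth 0 l 0 - nth 1 l 0))%nat).
  - intros l _. destruct (Nat.leb_spec (nth 0 l 0) (nth 1 l 0)); cbn [Nat.b2n]; lia.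
  - apply (computable_on_comp2 _ Nat.sub); auto using computable2_sub, computable_on_const.
    apply (computable_on_comp2 _ Nat.sub); auto using computable2_sub, computable_on_var.
Qed.

Create HintDb comput.

(** Syntax-directed. A function symbol not listed here must be known from the context or from
    [comput], so later proofs first make compound functions atomic with [set]. *)
Ltac computable :=
  lazymatch goal with
  | |- computable_on _ (fun l => nth _ l _) => apply computable_on_var
  | |- computable_on _ (fun l => nth _ (tl l) _) => apply computable_on_var1
  | |- computable_on _ (fun l => nth _ (tl (tl l)) _) => apply computable_on_var2
  | |- computable_on _ (fun l => S (@?A l)) =>
      apply (computable_on_comp1 _ S A computable1_S); computable
  | |- computable_on _ (fun l => Nat.add (@?A l) (@?B l)) =>
      apply (computable_on_comp2 _ Nat.add A B computable2_add); computable
  | |- computable_on _ (fun l => Nat.sub (@?A l) (@?B l)) =>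
      apply (computable_on_comp2 _ Nat.sub A B computable2_sub); computable
  | |- computable_on _ (fun l => Nat.mul (@?A l) (@?B l)) =>
      apply (computable_on_comp2 _ Nat.mul A B computable2_mul); computable
  | |- computable_on _ (fun l => Nat.b2n (Nat.leb (@?A l) (@?B l))) =>
      apply (computable_on_comp2 _ (fun a b => Nat.b2n (a <=? b)) A B computable2_leb);
      computable
  | |- computable_on ?k (fun l => nsum (@?B l) (fun i => @?F i l)) =>
      apply (computable_on_sum k B (fun i l => F i l)); cbv beta; computable
  | |- computable_on _ (fun l => ?f (@?A l) (@?B l)) =>
      apply (computable_on_comp2 _ f A B); [assumption || auto with comput | computable | computable]
  | |- computable_on _ (fun l => ?f (@?A l)) =>
      apply (computable_on_comp1 _ f A); [assumption || auto with comput | computable]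
  | |- computable_on ?k (fun _ => ?c) => apply (computable_on_const k c)
  end.

(** * Inverting the Cantor pairing *)

Definition tri (s : nat) : nat := nsum s (fun t => S t).

Lemma computable1_tri : computable1 tri.
Proof. apply computable1_of; unfold tri. computable. Qed.
#[local] Hint Resolve computable1_tri : comput.

(** The largest [s] with [tri s <= n], obtained as a count. Applied to the Cantor code of a pair it
    recovers the sum of the components. *)
Definition tri_root (n : nat) : nat := nsum n (fun t => Nat.b2n (tri (S t) <=? n)).

Lemma computable1_tri_root : computable1 tri_root.
Proof. apply computable1_of; unfold tri_root. computable. Qed.
#[local] Hint Resolve computable1_tri_root : comput.

Lemma tri_mono s t : (s <= t)%nat -> (tri s <= tri t)%nat.
Proof. induction 1; unfold tri in *; simpl; lia. Qed.

Lemma nsum_ext n f g : (forall i, (i < n)%nat -> f i = g i) -> nsum n f = nsum n g.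
Proof. induction n; simpl; intros H; auto. rewrite IHn, H; auto. Qed.

Lemma nsum_below n s : nsum n (fun t => Nat.b2n (S t <=? s)) = Nat.min n s.
Proof.
  induction n; auto; cbn [nsum]; rewrite IHn; destruct (Nat.leb_spec (S n) s); simpl Nat.b2n; lia.
Qed.

Lemma le_tri s : (s <= tri s)%nat.
Proof. induction s; unfold tri in *; simpl; lia. Qed.

Lemma to_nat_tri x y : Cantor.to_nat (x, y) = (y + tri (x + y))%nat.
Proof.
  unfold Cantor.to_nat. rewrite (Nat.add_comm x y).
  f_equal; induction (y + x)%nat as [|n IH]; unfold tri, nat_rec in *; auto.
  cbn [nsum nat_rect]; rewrite IH; lia.
Qed.

Lemma tri_root_to_nat x y : tri_root (y + tri (x + y)) = (x + y)%nat.
Proof.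
  unfold tri_root.
  rewrite nsum_ext with (g := fun t => Nat.b2n (S t <=? x + y)).
  - rewrite nsum_below. pose proof (le_tri (x + y)); lia.
  - intros t _. f_equal.
    destruct (Nat.leb_spec (S t) (x + y)); [apply Nat.leb_le | apply Nat.leb_gt].
    + pose proof (tri_mono _ _ H); lia.
    + assert (Ht : (S (x + y) <= S t)%nat) by lia.
      apply tri_mono in Ht. unfold tri in *; cbn [nsum] in *; lia.
Qed.

Lemma snd_of_nat n : snd (Cantor.of_nat n) = (n - tri (tri_root n))%nat.
Proof.
  rewrite <- (Cantor.cancel_to_of n) at 2 3. destruct (Cantor.of_nat n) as [x y].
  rewrite to_nat_tri, tri_root_to_nat; simpl; lia.
Qed.

Lemma fst_of_nat n : fst (Cantor.of_nat n) = (tri_root n - (n - tri (tri_root n)))%nat.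
Proof.
  rewrite <- (Cantor.cancel_to_of n) at 2 3 4. destruct (Cantor.of_nat n) as [x y].
  rewrite to_nat_tri, tri_root_to_nat; simpl; lia.
Qed.

Lemma computable1_snd_of_nat : computable1 (fun n => snd (Cantor.of_nat n)).
Proof.
  apply computable1_of.
  eapply computable_on_ext; [intros l _; apply snd_of_nat|]. computable.
Qed.

Lemma computable1_fst_of_nat : computable1 (fun n => fst (Cantor.of_nat n)).
Proof.
  apply computable1_of.
  eapply computable_on_ext; [intros l _; apply fst_of_nat|]. computable.
Qed.

Lemma computable2_to_nat : computable2 (fun x y => Cantor.to_nat (x, y)).
Proof.
  apply computable2_of.
  eapply computable_on_ext; [intros l _; apply to_nat_tri|]. computable.
Qed.

Lemma computable1_even : computable1 (fun n => Nat.b2n (Nat.even n)).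
Proof.
  apply computable1_of.
  apply computable_on_ext with (fun l => nat_rect (fun _ => nat) 1
    (fun n z => (1 - z)%nat) (nth 0 l 0)).
  - intros l _; induction (nth 0 l 0) as [|n IH]; auto.
    rewrite Nat.even_succ, <- Nat.negb_even; cbn [nat_rect]; rewrite <- IH.
    destruct (Nat.even n); auto.
  - apply (computable_on_rec 1 (fun _ => 1) (fun n z l => (1 - z)%nat)); computable.
Qed.

Lemma computable1_div2 : computable1 Nat.div2.
Proof.
  apply computable1_of.
  apply computable_on_ext with
    (fun l => nsum (nth 0 l 0) (fun t => Nat.b2n (2 * S t <=? nth 0 l 0))).
  - intros l _. set (n := nth 0 l 0).
    rewrite nsum_ext with (g := fun t => Nat.b2n (S t <=? Nat.div2 n)).
    + rewrite nsum_below. symmetry; apply Nat.min_r, Nat.lt_eq_cases.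
      destruct n; auto. left; apply Nat.lt_div2; lia.
    + intros t _; f_equal. pose proof (Nat.div2_odd n).
      destruct (Nat.odd n); cbn [Nat.b2n] in *;
      destruct (Nat.leb_spec (S t) (Nat.div2 n));
      [apply Nat.leb_le | apply Nat.leb_gt | apply Nat.leb_le | apply Nat.leb_gt]; lia.
  - computable.
Qed.
#[local] Hint Resolve computable1_snd_of_nat computable1_fst_of_nat computable2_to_nat
  computable1_even computable1_div2 : comput.

Close Scope nat_scope.
Open Scope R_scope.

(** * Unions of grid cells *)

Lemma pairwise_disjoint_app l l' :
  pairwise_disjoint l -> pairwise_disjoint l' ->
  (forall p q, In p l -> In q l' -> snd p <= fst q \/ snd q <= fst p) ->
  pairwise_disjoint (l ++ l').
Proof.
  induction l as [|[c d] l IH]; simpl; auto.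
  intros [H1 H2] H3 H; split.
  - apply Forall_app; split; auto.
    apply Forall_forall; intros q Hq. apply (H (c, d) q); auto.
  - apply IH; auto.
Qed.

Lemma total_length_app l l' :
  total_length (l ++ l') = total_length l + total_length l'.
Proof. induction l; simpl; [lra|]. unfold total_length in *. rewrite IHl; lra. Qed.

Lemma pairwise_disjoint_filter f l :
  pairwise_disjoint l -> pairwise_disjoint (filter f l).
Proof.
  induction l as [|[c d] l IH]; simpl; auto.
  intros [H1 H2]. destruct (f (c, d)); simpl; auto. split; auto.
  apply incl_Forall with l; auto. apply incl_filter.
Qed.

Lemma total_length_filter f l :
  total_length l =
  total_length (filter f l) + total_length (filter (fun p => negb (f p)) l).
Proof.
  induction l as [|p l IH]; simpl; [lra|].
  unfold total_length in *. rewrite IH; destruct (f p); simpl; lra.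
Qed.

(* The intervals other than the head split into those to its left and those to its right. *)
Lemma total_length_packed n : forall l a b, (length l <= n)%nat -> a <= b ->
  (forall p, In p l -> a <= fst p < snd p /\ snd p <= b) ->
  pairwise_disjoint l -> total_length l <= b - a.
Proof.
  induction n as [|n IH]; intros [|[c d] l] a b Hn Hab Hl Hd; simpl in *; try lra; try lia.
  destruct Hd as [Hcd Hd]. rewrite Forall_forall in Hcd.
  destruct (Hl (c, d) (or_introl eq_refl)) as [Hc Hd']; simpl in *.
  set (f := fun p : R * R => if Rle_dec (snd p) c then true else false).
  change (d - c + total_length l <= b - a).
  rewrite (total_length_filter f).
  assert (total_length (filter f l) <= c - a).
  { apply IH; try lra; [pose proof (filter_length_le f l); lia| |].
    - intros p Hp; apply filter_In in Hp as [Hp Hf]; unfold f in Hf.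
      destruct (Rle_dec (snd p) c); try discriminate.
      specialize (Hl p (or_intror Hp)); lra.
    - apply pairwise_disjoint_filter; auto. }
  assert (total_length (filter (fun p => negb (f p)) l) <= b - d).
  { apply IH; try lra; [pose proof (filter_length_le (fun p => negb (f p)) l); lia| |].
    - intros p Hp; apply filter_In in Hp as [Hp Hf]; unfold f in Hf.
      destruct (Rle_dec (snd p) c); try discriminate.
      specialize (Hl p (or_intror Hp)). specialize (Hcd p Hp); lra.
    - apply pairwise_disjoint_filter; auto. }
  lra.
Qed.

Fixpoint cells (M : nat) (ch : nat -> bool) (t : nat) : list (R * R) :=
  match t with
  | O => []
  | S t => if ch t then (INR t / INR M, INR (S t) / INR M) :: cells M ch t
           else cells M ch t
  end.

Lemma in_cells M ch t p : In p (cells M ch t) ->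
  exists j, (j < t)%nat /\ ch j = true /\ p = (INR j / INR M, INR (S j) / INR M).
Proof.
  induction t as [|t IH]; [intros []|].
  cbn [cells]. destruct (ch t) eqn:E; [intros [H|H]|intros H].
  - exists t; auto.
  - destruct (IH H) as (j & ? & ?); exists j; auto.
  - destruct (IH H) as (j & ? & ?); exists j; auto.
Qed.

Lemma div_INR_le M i j : (0 < M)%nat -> (i <= j)%nat -> INR i / INR M <= INR j / INR M.
Proof.
  intros HM H. apply lt_0_INR in HM. apply Rmult_le_compat_r.
  - left; apply Rinv_0_lt_compat; auto.
  - apply le_INR; auto.
Qed.

Lemma div_INR_lt M i j : (0 < M)%nat -> (i < j)%nat -> INR i / INR M < INR j / INR M.
Proof.
  intros HM H. apply lt_0_INR in HM. apply Rmult_lt_compat_r.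
  - apply Rinv_0_lt_compat; auto.
  - apply lt_INR; auto.
Qed.

Lemma div_INR_lt_inv M i j : (0 < M)%nat -> INR i / INR M < INR j / INR M -> (i < j)%nat.
Proof.
  intros HM H. destruct (Nat.lt_ge_cases i j) as [|Hji]; auto.
  pose proof (div_INR_le M j i HM Hji); lra.
Qed.

Lemma pairwise_disjoint_cells M ch t : (0 < M)%nat -> pairwise_disjoint (cells M ch t).
Proof.
  intros HM. induction t as [|t IH]; cbn [cells]; [exact I|].
  destruct (ch t); auto. split; auto.
  apply Forall_forall; intros p Hp. apply in_cells in Hp as (j & Hj & _ & ->).
  right. apply div_INR_le; auto.
Qed.

Lemma total_length_cells M ch t : (0 < M)%nat ->
  total_length (cells M ch t) = INR (nsum t (fun j => Nat.b2n (ch j))) / INR M.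
Proof.
  intros HM. pose proof (lt_0_INR _ HM).
  induction t as [|t IH]; cbn [cells nsum]; [simpl; field; lra|].
  rewrite plus_INR. destruct (ch t); cbn [Nat.b2n].
  - change (INR (S t) / INR M - INR t / INR M + total_length (cells M ch t)
      = (INR (nsum t (fun j => Nat.b2n (ch j))) + INR 1) / INR M).
    rewrite IH, S_INR. simpl; field; lra.
  - rewrite IH; simpl; field; lra.
Qed.

Lemma nsum_b2n_negb (ch : nat -> bool) t :
  (nsum t (fun j => Nat.b2n (ch j)) + nsum t (fun j => Nat.b2n (negb (ch j))) = t)%nat.
Proof. induction t; simpl; auto. destruct (ch t); simpl; lia. Qed.

Definition cell_extension (M : nat) (ch : nat -> bool) (j : nat) : nat :=
  Nat.b2n ((M <=? S j)%nat || ch (S j)).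
(** Truncated subtraction: [1 - j] is 1 for the cell 0 alone, whose left end thus becomes [-1/M]. *)
Definition cell_left (M j : nat) : R := (INR j - INR (1 - j)) / INR M.
Definition cell_right (M : nat) (ch : nat -> bool) (j : nat) : R :=
  INR (S j + cell_extension M ch j) / INR M.

(* Two adjacent chosen cells overlap, so that the grid point between them is covered;
   the extreme cells protrude from [0,1], so that 0 and 1 can be covered. *)
Definition cell_union (M : nat) (ch : nat -> bool) (y : R) : Prop :=
  0 <= y <= 1 /\
  exists j, (j < M)%nat /\ ch j = true /\ cell_left M j < y < cell_right M ch j.

Lemma cell_left_le M j : (0 < M)%nat -> cell_left M j <= INR j / INR M.
Proof.
  intros HM; apply lt_0_INR in HM. unfold cell_left.
  apply Rmult_le_compat_r; [left; apply Rinv_0_lt_compat; auto|].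
  pose proof (pos_INR (1 - j)); lra.
Qed.

Lemma cell_right_ge M ch j : (0 < M)%nat -> INR (S j) / INR M <= cell_right M ch j.
Proof. intros HM; apply div_INR_le; auto; lia. Qed.

(** The extension of a chosen cell runs only into another chosen cell or out of the unit interval,
    so overlaps add no measure. *)
Lemma cell_union_unchosen M ch i y : (0 < M)%nat -> (i < M)%nat -> ch i = false ->
  INR i / INR M < y < INR (S i) / INR M -> ~ cell_union M ch y.
Proof.
  intros HM Hi Hc Hy [_ (j & Hj & Hjc & Hl & Hr)].
  unfold cell_left in Hl.
  assert (j <= i)%nat.
  { destruct j as [|j]; [lia|].
    replace (1 - S j)%nat with 0%nat in Hl by lia.
    replace (INR (S j) - INR 0) with (INR (S j)) in Hl by (simpl; lra).
    assert (Hji : INR (S j) / INR M < INR (S i) / INR M) by lra.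
    apply div_INR_lt_inv in Hji; auto; lia. }
  unfold cell_right, cell_extension in Hr.
  assert (Hij : INR i / INR M < INR (S j + Nat.b2n ((M <=? S j)%nat || ch (S j))) / INR M)
    by lra.
  apply div_INR_lt_inv in Hij; auto.
  assert (i <> j) by congruence.
  destruct (Nat.leb_spec M (S j)); [lia|]. simpl orb in Hij.
  destruct (ch (S j)) eqn:E; cbn [Nat.b2n] in Hij; [|lia].
  assert (i = S j) by lia. congruence.
Qed.

(** Disjoint intervals inside the union, taken together with the unchosen cells, form a packing of
    the unit interval, which gives the upper bound. The chosen cells themselves attain it. *)
Lemma measure_cell_union M ch : (0 < M)%nat ->
  measure_is (cell_union M ch) (INR (nsum M (fun j => Nat.b2n (ch j))) / INR M).
Proof.
  intros HM. pose proof (lt_0_INR _ HM) as HM'. split.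
  - intros t (l & Hl & Hd & ->).
    rewrite Forall_forall in Hl.
    set (l' := cells M (fun j => negb (ch j)) M).
    assert (Hin : forall p, In p l -> 0 <= fst p < snd p /\ snd p <= 1).
    { intros p Hp. destruct (Hl p Hp) as [Hlt Hs]. repeat split; auto.
      - destruct (Rle_lt_dec 0 (fst p)) as [|Hneg]; auto. exfalso.
        pose proof (Rmin_l (snd p) 0); pose proof (Rmin_r (snd p) 0).
        assert (fst p < Rmin (snd p) 0) by (apply Rmin_glb_lt; auto).
        destruct (Hs ((fst p + Rmin (snd p) 0) / 2)) as [Hy _]; lra.
      - destruct (Rle_lt_dec (snd p) 1) as [|Hneg]; auto. exfalso.
        pose proof (Rmax_l (fst p) 1); pose proof (Rmax_r (fst p) 1).
        assert (Rmax (fst p) 1 < snd p) by (apply Rmax_lub_lt; auto).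
        destruct (Hs ((snd p + Rmax (fst p) 1) / 2)) as [Hy _]; lra. }
    assert (Hlen : total_length (l ++ l') <= 1 - 0).
    { apply (total_length_packed (length (l ++ l'))); auto; try lra.
      - intros p Hp; apply in_app_iff in Hp as [Hp|Hp]; auto.
        apply in_cells in Hp as (j & Hj & _ & ->). cbn [fst snd].
        pose proof (div_INR_le M 0 j HM (Nat.le_0_l j)).
        pose proof (div_INR_lt M j (S j) HM (Nat.lt_succ_diag_r j)).
        pose proof (div_INR_le M (S j) M HM Hj).
        replace (INR 0 / INR M) with 0 in * by (simpl; field; lra).
        replace (INR M / INR M) with 1 in * by (field; lra). lra.
      - apply pairwise_disjoint_app; auto; [apply pairwise_disjoint_cells; auto|].
        intros p q Hp Hq. apply in_cells in Hq as (j & Hj & Hc & ->).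
        apply negb_true_iff in Hc. cbn [fst snd].
        destruct (Rle_lt_dec (snd p) (INR j / INR M)) as [|H1]; auto.
        destruct (Rle_lt_dec (INR (S j) / INR M) (fst p)) as [|H2]; auto. exfalso.
        pose proof (div_INR_lt M j (S j) HM (Nat.lt_succ_diag_r j)).
        destruct (Hl p Hp) as [Hlt Hs].
        set (y := (Rmax (fst p) (INR j / INR M) + Rmin (snd p) (INR (S j) / INR M)) / 2).
        assert (Hy : (fst p < y < snd p) /\ (INR j / INR M < y < INR (S j) / INR M)).
        { unfold y, Rmax, Rmin; destruct (Rle_dec _ _), (Rle_dec _ _); lra. }
        apply (cell_union_unchosen M ch j y); auto; apply Hy || apply Hs, Hy. }
    rewrite total_length_app in Hlen. unfold l' in Hlen.
    rewrite total_length_cells in Hlen by auto.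
    pose proof (nsum_b2n_negb ch M) as HN. apply (f_equal INR) in HN.
    rewrite plus_INR in HN.
    apply Rmult_le_reg_r with (INR M); auto.
    apply Rmult_le_compat_r with (r := INR M) in Hlen; [|lra].
    field_simplify in Hlen; try lra. field_simplify; try lra.
  - intros b Hb. apply Hb. exists (cells M ch M); split; [|split].
    + apply Forall_forall; intros p Hp. apply in_cells in Hp as (j & Hj & Hc & ->).
      cbn [fst snd].
      split; [apply div_INR_lt; auto|]. intros y Hy. split.
      * pose proof (div_INR_le M 0 j HM (Nat.le_0_l j)).
        pose proof (div_INR_le M (S j) M HM Hj).
        replace (INR 0 / INR M) with 0 in * by (simpl; field; lra).
        replace (INR M / INR M) with 1 in * by (field; lra). lra.
      * exists j; repeat split; auto.
        -- pose proof (cell_left_le M j HM); lra.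
        -- pose proof (cell_right_ge M ch j HM); lra.
    + apply pairwise_disjoint_cells; auto.
    + symmetry; apply total_length_cells; auto.
Qed.

(** Cells that are not bad are added from left to right until the deficit is made up, so that
    exactly [K] cells are chosen. A total test needs a computable sum of measures, and here the
    measure is known in advance. *)
Definition padded (bad : nat -> bool) (M K j : nat) : bool :=
  bad j || (nsum j (fun i => Nat.b2n (negb (bad i)))
            <? K - nsum M (fun i => Nat.b2n (bad i)))%nat.

Lemma count_padded bad M K :
  (nsum M (fun i => Nat.b2n (bad i)) <= K <= M)%nat ->
  nsum M (fun i => Nat.b2n (padded bad M K i)) = K.
Proof.
  intros HK.
  assert (H : forall t, nsum t (fun i => Nat.b2n (padded bad M K i)) =
    (nsum t (fun i => Nat.b2n (bad i)) +
     Nat.min (nsum t (fun i => Nat.b2n (negb (bad i))))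
       (K - nsum M (fun i => Nat.b2n (bad i))))%nat).
  { induction t as [|t IH]; [reflexivity|].
    cbn [nsum]; rewrite IH; unfold padded at 1.
    destruct (bad t); cbn [orb negb Nat.b2n]; [lia|].
    destruct (Nat.ltb_spec (nsum t (fun i => Nat.b2n (negb (bad i))))
      (K - nsum M (fun i => Nat.b2n (bad i)))); cbn [Nat.b2n]; lia. }
  rewrite H. pose proof (nsum_b2n_negb bad M); lia.
Qed.

(** Even codes stand for the non-negative integers and code 1 for -1, hence the numerator code
    [2 * j + (1 - j)]; [M - 1] codes the denominator [M]. If the cell is not chosen the product is
    0, which codes the empty interval from 0 to 0. *)
Definition cell_code (M : nat) (ch : nat -> bool) (j : nat) : nat :=
  (Nat.b2n (S j <=? M) * Nat.b2n (ch j) *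
   Cantor.to_nat (Cantor.to_nat (2 * j + (1 - j), M - 1),
                  Cantor.to_nat (2 * (S j + cell_extension M ch j), M - 1)))%nat.

Lemma IZR_of_succ_nat_pred M : (0 < M)%nat ->
  IZR (Z.pos (Pos.of_succ_nat (M - 1))) = INR M.
Proof. intros HM. rewrite INR_IZR_INZ, Zpos_P_of_succ_nat. f_equal; lia. Qed.

Lemma R_of_code_nonneg p M : (0 < M)%nat ->
  R_of_code (Cantor.to_nat (2 * p, M - 1)%nat) = INR p / INR M.
Proof.
  intros HM. unfold R_of_code, Q_of_code. rewrite Cantor.cancel_of_to.
  unfold Z_of_code. rewrite Nat.even_mul, Nat.div2_double. simpl orb. cbv iota.
  unfold Q2R; cbn [Qnum Qden].
  rewrite IZR_of_succ_nat_pred, <- INR_IZR_INZ by auto. reflexivity.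
Qed.

Lemma R_of_code_cell_left M j : (0 < M)%nat ->
  R_of_code (Cantor.to_nat (2 * j + (1 - j), M - 1)%nat) = cell_left M j.
Proof.
  intros HM. destruct j as [|j].
  - unfold R_of_code, Q_of_code. rewrite Cantor.cancel_of_to.
    unfold cell_left, Q2R; cbn [Qnum Qden].
    rewrite IZR_of_succ_nat_pred by auto. change (Z_of_code (2 * 0 + (1 - 0))) with (-1)%Z. unfold Rdiv; f_equal; simpl; lra.
  - unfold cell_left. replace (1 - S j)%nat with 0%nat by lia.
    rewrite Nat.add_0_r, R_of_code_nonneg by auto. change (INR 0) with 0. rewrite Rminus_0_r. reflexivity.
Qed.

Lemma sigma01_cell_code g (M : nat -> nat) ch n x : (0 < M n)%nat ->
  (forall j, g n j = cell_code (M n) ch j) ->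
  sigma01_seq_of g n x <-> cell_union (M n) ch x.
Proof.
  intros HM Hg. unfold sigma01_seq_of, cell_union.
  split; intros [H01 (j & Hj)]; split; auto; exists j.
  - rewrite Hg in Hj. unfold cell_code in Hj.
    destruct (Nat.leb_spec (S j) (M n)); [destruct (ch j) eqn:E|].
    + unfold RR_of_code in Hj. cbn [Nat.b2n] in Hj.
      rewrite !Nat.mul_1_l, Cantor.cancel_of_to in Hj. cbn [fst snd] in Hj.
      change (j + (j + 0))%nat with (2 * j)%nat in Hj.
      rewrite R_of_code_cell_left, R_of_code_nonneg in Hj by auto. auto.
    + exfalso. cbn [Nat.b2n] in Hj. rewrite Nat.mul_0_r, Nat.mul_0_l in Hj. simpl in Hj.
      lra.
    + exfalso. cbn [Nat.b2n] in Hj. rewrite !Nat.mul_0_l in Hj. simpl in Hj.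
      lra.
  - destruct Hj as (Hj & Hc & Hx). rewrite Hg. unfold cell_code.
    destruct (Nat.leb_spec (S j) (M n)); [|lia]. rewrite Hc.
    cbn [Nat.b2n]. unfold RR_of_code.
    rewrite !Nat.mul_1_l, Cantor.cancel_of_to. cbn [fst snd].
    rewrite R_of_code_cell_left, R_of_code_nonneg by auto. auto.
Qed.

(** * A Solovay test from computable bad cells *)

(** With this many cells, any [W n] of them have total length exactly [1 / ((n+1)(n+2))]. *)
Definition grid_size (W : nat -> nat) (n : nat) : nat := (S n * S (S n) * W n)%nat.

Lemma computable1_grid_size W : computable1 W -> computable1 (grid_size W).
Proof. intros HW. apply computable1_of. unfold grid_size. computable. Qed.

Lemma b2n_orb a b : Nat.b2n (a || b) = (1 - (1 - Nat.b2n a) * (1 - Nat.b2n b))%nat.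
Proof. destruct a, b; reflexivity. Qed.

Lemma b2n_negb a : Nat.b2n (negb a) = (1 - Nat.b2n a)%nat.
Proof. destruct a; reflexivity. Qed.

Lemma computable2_padded M K bad :
  computable1 M -> computable1 K ->
  computable2 (fun n j => Nat.b2n (bad n j)) ->
  computable2 (fun n j => Nat.b2n (padded (bad n) (M n) (K n) j)).
Proof.
  intros HM HK Hbad.
  set (b := fun n j => Nat.b2n (bad n j)) in *.
  apply computable2_of. eapply computable_on_ext.
  { intros l _. unfold padded, Nat.ltb. rewrite b2n_orb.
    erewrite nsum_ext by (intros; apply b2n_negb).
    change (fun i => (1 - Nat.b2n (bad (nth 0 l 0%nat) i))%nat)
      with (fun i => (1 - b (nth 0 l 0%nat) i)%nat).
    change (fun i => Nat.b2n (bad (nth 0 l 0%nat) i)) with (fun i => b (nth 0 l 0%nat) i).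
    change (Nat.b2n (bad (nth 0 l 0%nat) (nth 1 l 0%nat)))
      with (b (nth 0 l 0%nat) (nth 1 l 0%nat)).
    reflexivity. }
  computable.
Qed.

Lemma computable2_cell_code M ch :
  computable1 M -> computable2 (fun n j => Nat.b2n (ch n j)) ->
  computable2 (fun n j => cell_code (M n) (ch n) j).
Proof.
  intros HM Hch.
  set (b := fun n j => Nat.b2n (ch n j)) in *.
  set (pair := fun x y => Cantor.to_nat (x, y)).
  assert (Hpair : computable2 pair) by exact computable2_to_nat.
  apply computable2_of. eapply computable_on_ext.
  { intros l _. unfold cell_code, cell_extension. rewrite b2n_orb.
    change (Nat.b2n (ch (nth 0 l 0%nat) (nth 1 l 0%nat)))
      with (b (nth 0 l 0%nat) (nth 1 l 0%nat)).
    change (Nat.b2n (ch (nth 0 l 0%nat) (S (nth 1 l 0%nat))))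
      with (b (nth 0 l 0%nat) (S (nth 1 l 0%nat))).
    repeat match goal with |- context [Cantor.to_nat (?x, ?y)] =>
      change (Cantor.to_nat (x, y)) with (pair x y) end.
    reflexivity. }
  computable.
Qed.

Lemma infinite_sum_telescope :
  infinite_sum (fun n => / (INR (S n) * INR (S (S n)))) 1.
Proof.
  assert (H : forall n,
    sum_f_R0 (fun n => / (INR (S n) * INR (S (S n)))) n = 1 - / INR (S (S n))).
  { induction n as [|n IH]; [simpl; field|].
    cbn [sum_f_R0]; rewrite IH.
    assert (0 < INR (S (S n))) by (apply lt_0_INR; lia).
    rewrite (S_INR (S (S n))). field; lra. }
  intros eps Heps. destruct (archimed_cor1 eps Heps) as (N & HN & HN0).
  exists N; intros n Hn. unfold R_dist. rewrite H.
  assert (0 < INR N) by (apply lt_0_INR; lia).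
  assert (INR N <= INR (S (S n))) by (apply le_INR; lia).
  assert (/ INR (S (S n)) <= / INR N) by (apply Rinv_le_contravar; auto).
  assert (0 < / INR (S (S n))) by (apply Rinv_0_lt_compat; lra).
  replace (1 - / INR (S (S n)) - 1) with (- / INR (S (S n))) by lra.
  rewrite Rabs_Ropp, Rabs_pos_eq; lra.
Qed.

Lemma computable_real_1 : computable_real 1.
Proof.
  exists (fun _ => Cantor.to_nat (2, 0)%nat); split.
  - apply computable1_of, computable_on_const.
  - intros n. change (2, 0)%nat with (2 * 1, 1 - 1)%nat.
    rewrite (R_of_code_nonneg 1 1) by lia. simpl INR.
    replace (1 / 1 - 1) with 0 by field. rewrite Rabs_R0.
    left; apply Rinv_0_lt_compat, pow_lt; lra.
Qed.

Lemma nat_floor (r : R) : 0 <= r -> exists j, INR j <= r < INR (S j).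
Proof.
  intros Hr. destruct (archimed r) as [H1 H2].
  assert (Hu : (0 < up r)%Z) by (apply lt_IZR; simpl; lra).
  exists (Z.to_nat (up r - 1)).
  rewrite S_INR, INR_IZR_INZ, Z2Nat.id, minus_IZR by lia. lra.
Qed.

(** Cells are read as half-open except the last, which must also hold [x = 1]; this is the final
    clause. *)
Lemma grid_cell (M : nat) (x : R) : (0 < M)%nat -> 0 <= x <= 1 ->
  exists j, (j < M)%nat /\ INR j / INR M <= x <= INR (S j) / INR M /\
    (x = INR (S j) / INR M -> S j = M).
Proof.
  intros HM Hx. pose proof (lt_0_INR _ HM) as HM'.
  destruct (nat_floor (x * INR M)) as (j & Hj1 & Hj2); [apply Rmult_le_pos; lra|].
  assert (D : forall i, INR i = INR i / INR M * INR M) by (intros; field; lra).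
  destruct (Nat.lt_ge_cases j M) as [Hj|Hj].
  - exists j; split; auto. rewrite (D j) in Hj1. rewrite (D (S j)) in Hj2.
    apply Rmult_le_reg_r in Hj1; auto. apply Rmult_lt_reg_r in Hj2; auto.
    split; [lra|]. intros; lra.
  - assert (x = 1).
    { apply le_INR in Hj. apply Rle_antisym; [lra|].
      apply Rmult_le_reg_r with (INR M); lra. }
    exists (M - 1)%nat. replace (S (M - 1)) with M by lia.
    subst x. pose proof (div_INR_le M (M - 1) M HM (Nat.le_sub_l M 1)).
    replace (INR M / INR M) with 1 in * by (field; lra).
    split; [lia|]. split; auto. lra.
Qed.

(** A grid point belongs to two closed cells and is covered only if both are chosen, through the
    extension of the left one. Hence the hypothesis on every closed cell containing [x]. *)
Lemma cell_union_of_bad_cells M ch x : (0 < M)%nat -> 0 <= x <= 1 ->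
  (forall j, (j < M)%nat -> INR j / INR M <= x <= INR (S j) / INR M -> ch j = true) ->
  cell_union M ch x.
Proof.
  intros HM Hx Hch. split; auto.
  destruct (grid_cell M x HM Hx) as (j & Hj & Hxj & Hend).
  pose proof (Hch j Hj Hxj) as Hc.
  pose proof (lt_0_INR _ HM) as HM'.
  pose proof (cell_right_ge M ch j HM) as Hr.
  assert (Hr' : x < cell_right M ch j).
  { destruct (Req_dec x (INR (S j) / INR M)) as [E|]; [|lra].
    specialize (Hend E). rewrite E. unfold cell_right, cell_extension.
    rewrite (proj2 (Nat.leb_le M (S j))) by lia.
    apply div_INR_lt; auto; simpl; lia. }
  destruct j as [|j].
  - exists 0%nat; repeat split; auto.
    apply Rlt_le_trans with (INR 0 / INR M); [|lra].
    unfold cell_left; apply Rmult_lt_compat_r; [apply Rinv_0_lt_compat; auto|simpl; lra].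
  - destruct (Req_dec x (INR (S j) / INR M)) as [E|].
    + exists j. assert (Hcj : ch j = true).
      { apply Hch; [lia|]. rewrite E. split; [|lra].
        apply div_INR_le; auto. }
      repeat split; auto; [lia| |].
      * apply Rle_lt_trans with (INR j / INR M); [apply cell_left_le; auto|].
        rewrite E; apply div_INR_lt; auto.
      * rewrite E. unfold cell_right, cell_extension. rewrite Hc, orb_true_r.
        apply div_INR_lt; auto; simpl; lia.
    + exists (S j); repeat split; auto.
      pose proof (cell_left_le M (S j) HM); lra.
Qed.

(** The padded unions form a total Solovay test, so a random [x] eventually leaves them, and then
    not every cell containing [x] can be bad. *)
Lemma schnorr_random_good_cell (x : R) (W : nat -> nat) (bad : nat -> nat -> bool) :
  0 <= x <= 1 -> schnorr_random x -> computable1 W ->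
  computable2 (fun n j => Nat.b2n (bad n j)) ->
  (forall n, (0 < W n)%nat) ->
  (forall n, (nsum (grid_size W n) (fun j => Nat.b2n (bad n j)) <= W n)%nat) ->
  exists N, forall n, (N <= n)%nat -> exists j, (j < grid_size W n)%nat /\
    INR j / INR (grid_size W n) <= x <= INR (S j) / INR (grid_size W n) /\
    bad n j = false.
Proof.
  intros Hx Hrand HW Hbad HW0 Hcount.
  set (M := grid_size W) in *.
  set (ch := fun n => padded (bad n) (M n) (W n)).
  assert (HM : forall n, (0 < M n)%nat).
  { intros n; unfold M, grid_size. specialize (HW0 n). nia. }
  set (g := fun n j => cell_code (M n) (ch n) j).
  assert (HA : forall n y, sigma01_seq_of g n y <-> cell_union (M n) (ch n) y).
  { intros n y; apply sigma01_cell_code; auto. }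
  destruct (Hrand (sigma01_seq_of g)) as [N HN].
  - split.
    + exists g; split; [|tauto]. apply computable2_cell_code.
      * apply computable1_grid_size; auto.
      * apply computable2_padded; auto. apply computable1_grid_size; auto.
    + exists (fun n => / (INR (S n) * INR (S (S n)))); split.
      * intros n. pose proof (measure_cell_union (M n) (ch n) (HM n)) as Hm.
        assert (HWn : 0 < INR (W n)) by (apply lt_0_INR; auto).
        assert (0 < INR (S n)) by (apply lt_0_INR; lia).
        assert (0 < INR (S (S n))) by (apply lt_0_INR; lia).
        unfold ch at 2 in Hm. rewrite count_padded in Hm.
        2:{ split; auto. unfold M, grid_size. nia. }
        replace (/ (INR (S n) * INR (S (S n)))) with (INR (W n) / INR (M n)).
        2:{ unfold M, grid_size. rewrite !mult_INR. field; lra. }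
        destruct Hm as [Hub Hlub]; split.
        -- intros t (l & Hl & Ht); apply Hub; exists l; split; auto.
           eapply Forall_impl; [|exact Hl]. intros p [Hp Hs]; split; auto.
           intros y Hy; apply HA; auto.
        -- intros b Hb; apply Hlub. intros t (l & Hl & Ht); apply Hb; exists l; split; auto.
           eapply Forall_impl; [|exact Hl]. intros p [Hp Hs]; split; auto.
           intros y Hy; apply HA; auto.
      * exists 1; split; [exact infinite_sum_telescope|exact computable_real_1].
  - exists N; intros n Hn. specialize (HN n Hn). rewrite HA in HN.
    (* The covering lemma only refutes that all cells at [x] are chosen; a finite search extracts
       one that is not bad. *)
    destruct (existsb (fun j => (if Rle_dec (INR j / INR (M n)) x then true else false)
      && (if Rle_dec x (INR (S j) / INR (M n)) then true else false)
      && negb (bad n j)) (seq 0 (M n))) eqn:E.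
    + apply existsb_exists in E as (j & Hj & E). apply in_seq in Hj.
      exists j. destruct (Rle_dec _ _); [|discriminate].
      destruct (Rle_dec _ _); [|discriminate].
      apply negb_true_iff in E. repeat split; auto; lia.
    + exfalso; apply HN, cell_union_of_bad_cells; auto.
      intros j Hj Hxj. destruct (bad n j) eqn:Eb; [unfold ch, padded; rewrite Eb; auto|].
      exfalso. rewrite <- not_true_iff_false in E; apply E.
      apply existsb_exists; exists j; split; [apply in_seq; lia|].
      destruct (Rle_dec _ _); [|lra]. destruct (Rle_dec _ _); [|lra].
      rewrite Eb; auto.
Qed.

(** * Exponential sums and the Fejer kernel *)

Fixpoint rsum (n : nat) (f : nat -> R) : R :=
  match n with O => 0 | S m => rsum m f + f m end.

Lemma rsum_ext n f g : (forall i, (i < n)%nat -> f i = g i) -> rsum n f = rsum n g.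
Proof. induction n; simpl; intros H; auto. rewrite IHn, H; auto. Qed.

Lemma rsum_plus n f g : rsum n (fun i => f i + g i) = rsum n f + rsum n g.
Proof. induction n; simpl; [lra|]. rewrite IHn; lra. Qed.

Lemma rsum_scal n a f : rsum n (fun i => a * f i) = a * rsum n f.
Proof. induction n; simpl; [lra|]. rewrite IHn; lra. Qed.

Lemma rsum_const n a : rsum n (fun _ => a) = INR n * a.
Proof. induction n; [simpl; lra|]. rewrite S_INR; simpl; rewrite IHn; lra. Qed.

Lemma rsum_le n f g : (forall i, (i < n)%nat -> f i <= g i) -> rsum n f <= rsum n g.
Proof. induction n; simpl; intros H; [lra|]. apply Rplus_le_compat; auto. Qed.

Lemma rsum_nonneg n f : (forall i, (i < n)%nat -> 0 <= f i) -> 0 <= rsum n f.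
Proof. induction n; simpl; intros H; [lra|]. apply Rplus_le_le_0_compat; auto. Qed.

Lemma rsum_swap n m f :
  rsum n (fun i => rsum m (fun j => f i j)) = rsum m (fun j => rsum n (fun i => f i j)).
Proof.
  induction n; simpl.
  - induction m; simpl; lra.
  - rewrite IHn, <- rsum_plus; auto.
Qed.

Lemma rsum_term_le n f i : (forall i, (i < n)%nat -> 0 <= f i) -> (i < n)%nat ->
  f i <= rsum n f.
Proof.
  induction n; simpl; intros H Hi; [lia|].
  destruct (Nat.eq_dec i n) as [->|].
  - pose proof (rsum_nonneg n f). assert (0 <= rsum n f) by auto. lra.
  - assert (f i <= rsum n f) by (apply IHn; auto; lia).
    assert (0 <= f n) by auto. lra.
Qed.

Lemma rsum_telescope n g : rsum n (fun i => g i - g (S i)) = g 0%nat - g n.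
Proof. induction n; simpl; [lra|]. rewrite IHn; lra. Qed.

Lemma rsum_add n m f : rsum (n + m) f = rsum n f + rsum m (fun i => f (n + i)%nat).
Proof.
  induction m; simpl; [rewrite Nat.add_0_r; lra|].
  rewrite Nat.add_succ_r; simpl; rewrite IHm; lra.
Qed.

Lemma INR_nsum n f : INR (nsum n f) = rsum n (fun i => INR (f i)).
Proof. induction n; simpl; auto. rewrite plus_INR, IHn; auto. Qed.

Lemma rsum_product n f g :
  rsum n f * rsum n g = rsum n (fun i => rsum n (fun j => f i * g j)).
Proof.
  rewrite Rmult_comm, <- rsum_scal. apply rsum_ext; intros i _.
  rewrite rsum_scal; lra.
Qed.

(** The squared modulus of the exponential sum of [e(h Y_i)] over [i < N], split into real and
    imaginary parts. *)
Definition energy (h : R) (N : nat) (Y : nat -> R) : R :=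
  Rsqr (rsum N (fun i => cos (2 * PI * h * Y i))) +
  Rsqr (rsum N (fun i => sin (2 * PI * h * Y i))).

Lemma energy_nonneg h N Y : 0 <= energy h N Y.
Proof. apply Rplus_le_le_0_compat; apply Rle_0_sqr. Qed.

Lemma energy_opp h N Y : energy (- h) N Y = energy h N Y.
Proof.
  unfold energy. f_equal.
  - f_equal; apply rsum_ext; intros i _. rewrite <- cos_neg; f_equal; ring.
  - rewrite Rsqr_neg. f_equal.
    replace (- rsum N (fun i => sin (2 * PI * - h * Y i)))
      with (-1 * rsum N (fun i => sin (2 * PI * - h * Y i))) by ring.
    rewrite <- rsum_scal; apply rsum_ext; intros i _.
    replace (2 * PI * - h * Y i) with (- (2 * PI * h * Y i)) by ring.
    rewrite sin_neg; ring.
Qed.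

Lemma energy_expand h N Y :
  energy h N Y = rsum N (fun i => rsum N (fun j => cos (2 * PI * h * (Y i - Y j)))).
Proof.
  unfold energy, Rsqr. rewrite !rsum_product, <- rsum_plus.
  apply rsum_ext; intros i _. rewrite <- rsum_plus. apply rsum_ext; intros j _.
  rewrite Rmult_minus_distr_l, cos_minus; ring.
Qed.

(** The shift by [q] rotates the exponential sum, and a real part is at most the modulus. The defect
    in this Cauchy-Schwarz inequality is the square [(sin t * C - cos t * S)^2]. *)
Lemma shifted_cos_sum_le h N Y q b : 0 <= b -> energy h N Y <= Rsqr b ->
  rsum N (fun i => cos (2 * PI * h * (Y i - q))) <= b.
Proof.
  intros Hb HE. unfold energy in HE.
  set (C := rsum N (fun i => cos (2 * PI * h * Y i))) in *.
  set (S := rsum N (fun i => sin (2 * PI * h * Y i))) in *.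
  set (t := 2 * PI * h * q).
  assert (E : rsum N (fun i => cos (2 * PI * h * (Y i - q))) = cos t * C + sin t * S).
  { unfold C, S. rewrite <- !rsum_scal, <- rsum_plus. apply rsum_ext; intros i _.
    rewrite Rmult_minus_distr_l, cos_minus. fold t; ring. }
  rewrite E. apply Rsqr_incr_0_var; auto.
  apply Rle_trans with (2 := HE).
  pose proof (sin2_cos2 t) as H1. unfold Rsqr in *.
  assert (0 <= (sin t * C - cos t * S) * (sin t * C - cos t * S)) by apply Rle_0_sqr.
  replace (C * C + S * S) with
    ((sin t * sin t + cos t * cos t) * (C * C + S * S)) by (rewrite H1; ring).
  nra.
Qed.

(* [energy y n INR / n] is the Fejer kernel at [y]. *)
Lemma fejer_decay y n : (1 - cos (2 * PI * y)) * energy y n INR <= 4.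
Proof.
  replace (1 - cos (2 * PI * y)) with (2 * Rsqr (sin (PI * y))).
  2:{ replace (2 * PI * y) with (2 * (PI * y)) by ring. rewrite cos_2a_sin.
      unfold Rsqr; ring. }
  set (s := sin (PI * y)).
  set (u := fun k => sin (PI * y * (2 * INR k - 1))).
  set (v := fun k => cos (PI * y * (2 * INR k - 1))).
  (* The factor [2 sin(PI y)] makes both sums over an arithmetic progression telescope through
     half-steps. *)
  assert (HC : 2 * s * rsum n (fun i => cos (2 * PI * y * INR i)) = - (u 0%nat - u n)).
  { rewrite <- rsum_telescope, <- rsum_scal.
    replace (- rsum n (fun i => u i - u (S i)))
      with (-1 * rsum n (fun i => u i - u (S i))) by ring.
    rewrite <- rsum_scal. apply rsum_ext; intros i _. unfold u, s.
    rewrite S_INR.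
    replace (PI * y * (2 * INR i - 1)) with (2 * PI * y * INR i - PI * y) by ring.
    replace (PI * y * (2 * (INR i + 1) - 1)) with (2 * PI * y * INR i + PI * y) by ring.
    rewrite sin_minus, sin_plus; ring. }
  assert (HS : 2 * s * rsum n (fun i => sin (2 * PI * y * INR i)) = v 0%nat - v n).
  { rewrite <- rsum_telescope, <- rsum_scal.
    apply rsum_ext; intros i _. unfold v, s.
    rewrite S_INR.
    replace (PI * y * (2 * INR i - 1)) with (2 * PI * y * INR i - PI * y) by ring.
    replace (PI * y * (2 * (INR i + 1) - 1)) with (2 * PI * y * INR i + PI * y) by ring.
    rewrite cos_minus, cos_plus; ring. }
  unfold energy. set (C := rsum n (fun i => cos (2 * PI * y * INR i))) in *.
  set (D := rsum n (fun i => sin (2 * PI * y * INR i))) in *.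
  assert (B : forall a b : R, -1 <= a <= 1 -> -1 <= b <= 1 -> Rsqr (a - b) <= 4).
  { intros a b Ha Hb. replace 4 with (Rsqr 2) by (unfold Rsqr; ring).
    apply neg_pos_Rsqr_le; lra. }
  assert (HC2 : Rsqr (2 * s * C) <= 4).
  { rewrite HC, <- Rsqr_neg. apply B; apply SIN_bound. }
  assert (HS2 : Rsqr (2 * s * D) <= 4).
  { rewrite HS. apply B; apply COS_bound. }
  unfold Rsqr in *. lra.
Qed.

Lemma cos_period_Z x z : cos (x + 2 * PI * IZR z) = cos x.
Proof.
  assert (H : forall x n, cos (x + 2 * PI * IZR (Z.of_nat n)) = cos x).
  { intros x0 n. rewrite <- (cos_period x0 n), INR_IZR_INZ. f_equal; ring. }
  destruct (Z_le_gt_dec 0 z).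
  - rewrite <- (Z2Nat.id z) by lia. apply H.
  - rewrite <- (H (x + 2 * PI * IZR z) (Z.to_nat (- z))).
    rewrite Z2Nat.id, opp_IZR by lia. f_equal; ring.
Qed.

Lemma INR_minus_cases (k l n : nat) : (k < n)%nat -> (l < n)%nat -> k <> l ->
  exists m, (S m < n)%nat /\
    (INR k - INR l = INR (S m) \/ INR k - INR l = - INR (S m)).
Proof.
  intros Hk Hl Hkl. destruct (Nat.lt_ge_cases k l).
  - exists (l - k - 1)%nat; split; [lia|right].
    replace (S (l - k - 1)) with (l - k)%nat by lia. rewrite minus_INR by lia; ring.
  - exists (k - l - 1)%nat; split; [lia|left].
    replace (S (k - l - 1)) with (k - l)%nat by lia. rewrite minus_INR by lia; ring.
Qed.

(** The factor [2 sin(PI d / n)] is non-zero because [0 < |d| < n]. It makes the sum telescope, and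
    the two ends differ by [d] full periods. *)
Lemma root_of_unity_cos_sum n k l a : (k < n)%nat -> (l < n)%nat -> k <> l ->
  rsum n (fun t => cos (a - 2 * PI * (INR k - INR l) * (INR t / INR n))) = 0.
Proof.
  intros Hk Hl Hkl.
  assert (Hn : 0 < INR n) by (apply lt_0_INR; lia).
  set (d := INR k - INR l). set (s := sin (PI * d / INR n)).
  assert (Hs : s <> 0).
  { destruct (INR_minus_cases k l n Hk Hl Hkl) as (m & Hm & Hd).
    apply lt_INR in Hm. assert (Hm0 : 0 < INR (S m)) by (apply lt_0_INR; lia).
    pose proof PI_RGT_0.
    assert (Hpos : 0 < sin (PI * INR (S m) / INR n)).
    { apply sin_gt_0.
      - apply Rdiv_lt_0_compat; auto. apply Rmult_lt_0_compat; auto.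
      - apply Rmult_lt_reg_r with (INR n); auto. unfold Rdiv.
        rewrite Rmult_assoc, Rinv_l by lra. rewrite Rmult_1_r.
        apply Rmult_lt_compat_l; auto. }
    unfold s, d; destruct Hd as [-> | ->]; [lra|].
    replace (PI * - INR (S m) / INR n) with (- (PI * INR (S m) / INR n)) by (field; lra).
    rewrite sin_neg; lra. }
  apply Rmult_eq_reg_l with (2 * s); [|lra].
  set (g := fun t => sin (a + PI * d / INR n - 2 * PI * d * (INR t / INR n))).
  rewrite <- rsum_scal, (rsum_ext _ _ (fun t => g t - g (S t))), rsum_telescope.
  - unfold g. rewrite Rmult_0_r. apply Rminus_diag_eq.
    replace (INR n / INR n) with 1 by (field; lra).
    replace (INR 0 / INR n) with 0 by (simpl; field; lra).
    set (b := a + PI * d / INR n).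
    (* Adding [k] periods on one side and [l] on the other avoids a case split on the sign of
       [d = k - l]. *)
    rewrite <- (sin_period (b - 2 * PI * d * 1) k), <- (sin_period (b - 2 * PI * d * 0) l).
    f_equal. unfold d; ring.
  - intros t _. unfold g, s. rewrite S_INR.
    set (x := a - 2 * PI * d * (INR t / INR n)). set (p := PI * d / INR n).
    replace (a + p - 2 * PI * d * (INR t / INR n)) with (x + p) by (unfold x, p; ring).
    replace (a + p - 2 * PI * d * ((INR t + 1) / INR n)) with (x - p)
      by (unfold x, p; field; lra).
    rewrite sin_plus, sin_minus; ring.
Qed.

Lemma rsum_indicator n k a : (k < n)%nat ->
  rsum n (fun l => if Nat.eq_dec k l then a else 0) = a.
Proof.
  induction n; simpl; intros H; [lia|].
  destruct (Nat.eq_dec k n) as [->|].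
  - rewrite (rsum_ext n _ (fun _ => 0)), rsum_const; [ring|].
    intros i Hi; destruct (Nat.eq_dec n i); auto; lia.
  - rewrite IHn by lia; ring.
Qed.

(** Averaging over [n] equally spaced centres kills every non-zero frequency and leaves the
    diagonal, whatever [y] and [p] are. *)
Lemma fejer_average n p y : (0 < n)%nat ->
  rsum n (fun t => energy (y - (p + INR t) / INR n) n INR) = INR n * INR n.
Proof.
  intros Hn. assert (Hn' : 0 < INR n) by (apply lt_0_INR; lia).
  erewrite rsum_ext by (intros; apply energy_expand).
  rewrite rsum_swap.
  rewrite (rsum_ext n _ (fun _ => INR n)), rsum_const; auto.
  intros k Hk. rewrite rsum_swap.
  rewrite (rsum_ext n _ (fun l => if Nat.eq_dec k l then INR n else 0)).
  - apply rsum_indicator; auto.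
  - intros l Hl. destruct (Nat.eq_dec k l) as [<-|Hkl].
    + rewrite (rsum_ext n _ (fun _ => 1)), rsum_const; [ring|].
      intros t _. rewrite Rminus_diag, Rmult_0_r. apply cos_0.
    + rewrite <- (root_of_unity_cos_sum n k l (2 * PI * (INR k - INR l) * (y - p / INR n)))
        by auto.
      apply rsum_ext; intros t _. f_equal. field; lra.
Qed.

Definition in_arc (c w y : R) : Prop := exists z : Z, c <= y - IZR z <= c + w.

Lemma cos_le_away d t : 0 <= d -> d <= t <= 1 - d -> cos (2 * PI * t) <= cos (2 * PI * d).
Proof.
  intros Hd Ht. pose proof PI_RGT_0.
  destruct (Rle_lt_dec t (1/2)).
  - apply cos_decr_1; nra.
  - replace (cos (2 * PI * t)) with (cos (2 * PI * (1 - t))).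
    + apply cos_decr_1; nra.
    + rewrite <- (cos_neg (2 * PI * (1 - t))).
      rewrite <- (cos_period_Z (- (2 * PI * (1 - t))) 1). f_equal; ring.
Qed.

Lemma cos_lt_1 d : 0 < d < 1 / 2 -> cos (2 * PI * d) < 1.
Proof.
  intros Hd. pose proof PI_RGT_0. rewrite <- cos_0. apply cos_decreasing_1; nra.
Qed.

(** Expanding the kernel into frequencies [k - l] and summing over the points first, the diagonal
    gives [n * N] and each other pair a shifted cosine sum of the points, at most [b]. *)
Lemma fejer_row_sum_le n N Y q b : 0 <= b ->
  (forall m, (S m < n)%nat -> energy (INR (S m)) N Y <= Rsqr b) ->
  rsum N (fun i => energy (Y i - q) n INR) <= INR n * INR N + INR n * INR n * b.
Proof.
  intros Hb HE.
  erewrite rsum_ext by (intros; apply energy_expand).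
  rewrite rsum_swap.
  replace (INR n * INR N + INR n * INR n * b)
    with (INR n * (INR N + INR n * b)) by ring.
  rewrite <- rsum_const. apply rsum_le; intros k Hk. rewrite rsum_swap.
  replace (INR N + INR n * b) with
    (rsum n (fun l => (if Nat.eq_dec k l then INR N else 0) + b)).
  2:{ rewrite rsum_plus, rsum_indicator, rsum_const; auto. }
  apply rsum_le; intros l Hl. destruct (Nat.eq_dec k l) as [<-|Hkl].
  - rewrite (rsum_ext N _ (fun _ => 1)), rsum_const; [lra|].
    intros i _. rewrite Rminus_diag, Rmult_0_r. apply cos_0.
  - rewrite Rplus_0_l.
    rewrite (rsum_ext N _ (fun i => cos (2 * PI * (INR k - INR l) * (Y i - q))))
      by (intros; f_equal; ring).
    apply shifted_cos_sum_le; auto.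
    destruct (INR_minus_cases k l n Hk Hl Hkl) as (m & Hm & [-> | ->]);
      rewrite ?energy_opp; auto.
Qed.

(* A quantitative Weyl criterion in the style of Erdos and Turan: an arc hit too often
   forces a large exponential sum. The indicator of the arc is majorized by the average
   of the Fejer kernels centred at the multiples of [1/n] near the arc. *)
Lemma crowded_arc_energy c w eps : 0 <= w -> 0 < eps ->
  exists (n : nat) (c0 : R), 0 < c0 /\
  forall (N : nat) (Y : nat -> R) (B : nat -> bool),
    (forall i, (i < N)%nat -> B i = true -> in_arc c w (Y i)) ->
    INR N * (w + eps) < INR (nsum N (fun i => Nat.b2n (B i))) ->
    c0 * Rsqr (INR N) <= rsum n (fun m => energy (INR (S m)) N Y).
Proof.
  intros Hw Heps.
  destruct (Rle_lt_dec 1 (w + eps)) as [Hbig|Hsmall].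
  { exists 0%nat, 1; split; [lra|]. intros N Y B _ Hhit. exfalso.
    assert (Hle : (nsum N (fun i => Nat.b2n (B i)) <= N)%nat).
    { clear. induction N; simpl; auto. destruct (B N); simpl; lia. }
    apply le_INR in Hle. pose proof (pos_INR N). nra. }
  (* The total loss is [5 d]: [2 d] for widening the arc, [d] for rounding up the number of centres
     ([1 < n d]), [d] for the exponential sums and [d] for the kernel tails ([4 < n d s]). *)
  set (d := eps / 8).
  set (s := 1 - cos (2 * PI * d)).
  assert (Hs : 0 < s) by (unfold s; assert (cos (2 * PI * d) < 1) by (apply cos_lt_1; unfold d; lra); lra).
  destruct (archimed_cor1 (Rmin d (d * s / 4))) as (n & Hn & Hn0).
  { apply Rmin_glb_lt; [unfold d; lra|]. unfold d; apply Rdiv_lt_0_compat; nra. }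
  assert (Hn' : 0 < INR n) by (apply lt_0_INR; lia).
  assert (Hnd : 1 < INR n * d).
  { apply Rmult_lt_reg_l with (/ INR n); [apply Rinv_0_lt_compat; auto|].
    rewrite <- Rmult_assoc, Rinv_l by lra. pose proof (Rmin_l d (d * s / 4)). lra. }
  assert (Hns : 4 < INR n * (d * s)).
  { apply Rmult_lt_reg_l with (/ INR n); [apply Rinv_0_lt_compat; auto|].
    rewrite <- Rmult_assoc, Rinv_l by lra. pose proof (Rmin_r d (d * s / 4)). lra. }
  exists n, (Rsqr (d / INR n)).
  assert (Hdn : 0 < d / INR n) by (apply Rdiv_lt_0_compat; unfold d; lra).
  split; [apply Rsqr_pos_lt; lra|].
  intros N Y B HB Hhit.
  destruct (Rle_lt_dec (Rsqr (d / INR n) * Rsqr (INR N))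
    (rsum n (fun m => energy (INR (S m)) N Y))) as [|Hlow]; auto. exfalso.
  set (b := d / INR n * INR N).
  assert (Hb : 0 <= b) by (apply Rmult_le_pos; [lra|apply pos_INR]).
  assert (HE : forall m, (S m < n)%nat -> energy (INR (S m)) N Y <= Rsqr b).
  { intros m Hm. unfold b; rewrite Rsqr_mult.
    apply Rle_trans with (2 := Rlt_le _ _ Hlow).
    apply (rsum_term_le n (fun m => energy (INR (S m)) N Y)); [|lia].
    intros; apply energy_nonneg. }
  (* Centres are [(p + t) / n], starting just past [c - d]. Those with [t < m] serve the arc; those
     with [m <= t < n] fill the rest of the circle and stay at distance at least [d] from the arc
     modulo one. *)
  set (p := IZR (up (INR n * (c - d)))).
  destruct (archimed (INR n * (c - d))) as [Hp1 Hp2]. fold p in Hp1, Hp2.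
  destruct (archimed (INR n * (w + 2 * d))) as [Hm1 Hm2].
  assert (Hm0 : 0 <= INR n * (w + 2 * d)) by (apply Rmult_le_pos; unfold d; lra).
  set (mz := up (INR n * (w + 2 * d))) in *.
  assert (Hmz : (0 < mz)%Z) by (apply lt_IZR; simpl; lra).
  set (m := Z.to_nat mz).
  assert (Em : INR m = IZR mz) by (unfold m; rewrite INR_IZR_INZ, Z2Nat.id by lia; auto).
  assert (Hmn : (m <= n)%nat).
  { apply INR_le. rewrite Em. assert (INR n * (w + 3 * d) <= INR n * 1).
    { apply Rmult_le_compat_l; [lra|]. unfold d; lra. }
    lra. }
  set (e := fun t i => energy (Y i - (p + INR t) / INR n) n INR).
  assert (Hfar : forall i t, (i < N)%nat -> B i = true -> (m <= t < n)%nat -> e t i <= 4 / s).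
  { intros i t Hi HBi Ht. destruct (HB i Hi HBi) as [z Hz].
    assert (Hcos : cos (2 * PI * (Y i - (p + INR t) / INR n)) <= cos (2 * PI * d)).
    { rewrite <- cos_neg.
      replace (- (2 * PI * (Y i - (p + INR t) / INR n))) with
        (2 * PI * ((p + INR t) / INR n - (Y i - IZR z)) + 2 * PI * IZR (- z))
        by (rewrite opp_IZR; ring).
      rewrite cos_period_Z. apply cos_le_away; [unfold d; lra|].
      assert (Ht1 : INR m <= INR t) by (apply le_INR; lia).
      assert (Ht2 : INR t <= INR n - 1).
      { replace (INR n - 1) with (INR (n - 1)) by (rewrite minus_INR by lia; simpl; ring).
        apply le_INR; lia. }
      assert (c - d + (w + 2 * d) <= (p + INR t) / INR n).
      { apply Rmult_le_reg_l with (INR n); auto.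
        replace (INR n * ((p + INR t) / INR n)) with (p + INR t) by (field; lra). lra. }
      assert ((p + INR t) / INR n <= c - d + 1).
      { apply Rmult_le_reg_l with (INR n); auto.
        replace (INR n * ((p + INR t) / INR n)) with (p + INR t) by (field; lra). lra. }
      lra. }
    pose proof (fejer_decay (Y i - (p + INR t) / INR n) n) as HF.
    fold (e t i) in HF.
    assert (0 <= e t i) by apply energy_nonneg.
    apply Rmult_le_reg_l with s; auto.
    replace (s * (4 / s)) with 4 by (field; lra).
    apply Rle_trans with (2 := HF). apply Rmult_le_compat_r; auto. unfold s; lra. }
  (* All [n] kernels sum to [n^2]. At a hit the far ones take at most [n * (4 / s)] of this, so the
     near ones majorize the indicator of the hits. *)
  assert (Hnear : forall i, (i < N)%nat ->
    INR (Nat.b2n (B i)) * (INR n * INR n - INR n * (4 / s)) <= rsum m (fun t => e t i)).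
  { intros i Hi. destruct (B i) eqn:EB; cbn [Nat.b2n].
    - pose proof (fejer_average n p (Y i) Hn0) as HA.
      replace n with (m + (n - m))%nat in HA at 1 by lia.
      rewrite rsum_add in HA.
      assert (rsum (n - m) (fun t => e (m + t)%nat i) <= INR n * (4 / s)).
      { apply Rle_trans with (rsum (n - m) (fun _ => 4 / s)).
        - apply rsum_le; intros t Ht; apply Hfar; auto; lia.
        - rewrite rsum_const. apply Rmult_le_compat_r.
          + left; apply Rdiv_lt_0_compat; lra.
          + apply le_INR; lia. }
      unfold e in *. simpl (INR 1). lra.
    - simpl (INR 0). rewrite Rmult_0_l. apply rsum_nonneg; intros; apply energy_nonneg. }
  assert (Hup : rsum N (fun i => rsum m (fun t => e t i)) <=
    INR m * (INR n * INR N + INR n * INR n * b)).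
  { rewrite rsum_swap, <- rsum_const. apply rsum_le; intros t _.
    apply fejer_row_sum_le; auto. }
  apply rsum_le in Hnear.
  rewrite (rsum_ext N _ (fun i => (INR n * INR n - INR n * (4 / s)) * INR (Nat.b2n (B i))))
    in Hnear by (intros; ring).
  rewrite rsum_scal, <- (INR_nsum N (fun i => Nat.b2n (B i))) in Hnear.
  set (H := INR (nsum N (fun i => Nat.b2n (B i)))) in *.
  assert (HHN : H <= INR N).
  { apply le_INR. clear. induction N; simpl; auto. destruct (B N); simpl; lia. }
  assert (HN : 0 <= INR N) by apply pos_INR.
  assert (H0 : 0 <= H) by apply pos_INR.
  assert (Hs4 : 4 / s <= INR n * d).
  { apply Rmult_le_reg_l with s; auto.
    replace (s * (4 / s)) with 4 by (field; lra). lra. }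
  assert (K : (INR n * INR n) * (H * (1 - d)) <=
              (INR n * INR n) * (INR N * (w + 4 * d))).
  { apply Rle_trans with ((INR n * INR n - INR n * (4 / s)) * H).
    - assert (INR n * (4 / s) <= INR n * (INR n * d)) by (apply Rmult_le_compat_l; lra).
      nra.
    - apply Rle_trans with (1 := Hnear). apply Rle_trans with (1 := Hup).
      assert (Hmb : INR m <= INR n * (w + 3 * d)) by lra.
      assert (Hbn : INR n * b = d * INR N) by (unfold b; field; lra).
      assert (Hmn' : INR m <= INR n) by (apply le_INR; auto).
      replace (INR m * (INR n * INR N + INR n * INR n * b))
        with (INR n * (INR m * INR N + INR m * (INR n * b))) by ring.
      rewrite Hbn.
      assert (INR m * INR N <= INR n * (w + 3 * d) * INR N)
        by (apply Rmult_le_compat_r; auto).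
      assert (INR m * (d * INR N) <= INR n * (d * INR N)).
      { apply Rmult_le_compat_r; auto. apply Rmult_le_pos; auto; unfold d; lra. }
      replace (INR n * INR n * (INR N * (w + 4 * d))) with
        (INR n * (INR n * (w + 3 * d) * INR N + INR n * (d * INR N))) by ring.
      apply Rmult_le_compat_l; lra. }
  apply Rmult_le_reg_l in K; [|apply Rmult_lt_0_compat; auto].
  assert (d * H <= d * INR N) by (apply Rmult_le_compat_l; unfold d; lra).
  assert (INR N * (w + 5 * d) <= INR N * (w + eps)).
  { apply Rmult_le_compat_l; auto. unfold d; lra. }
  lra.
Qed.

(** * Mean squares of exponential sums *)

Definition cos_primitive (w y : R) : R := if Req_dec_T w 0 then y else sin (w * y) / w.

Lemma cos_primitive_derive w y : derivable_pt_lim (cos_primitive w) y (cos (w * y)).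
Proof.
  unfold cos_primitive; destruct (Req_dec_T w 0) as [->|Hw].
  - rewrite Rmult_0_l, cos_0. apply derivable_pt_lim_id.
  - replace (cos (w * y)) with (/ w * (cos (w * y) * (w * 1))) by (field; auto).
    intros eps Heps.
    assert (H : derivable_pt_lim (mult_real_fct (/ w) (comp sin (mult_real_fct w id))) y
      (/ w * (cos (w * y) * (w * 1)))).
    { apply derivable_pt_lim_scal.
      apply (derivable_pt_lim_comp (mult_real_fct w id) sin).
      - apply derivable_pt_lim_scal, derivable_pt_lim_id.
      - apply derivable_pt_lim_sin. }
    destruct (H eps Heps) as [delta Hd]. exists delta; intros h Hh0 Hh.
    specialize (Hd h Hh0 Hh). unfold mult_real_fct, comp, id in Hd.
    unfold Rdiv at 2 3. rewrite (Rmult_comm _ (/ w)), (Rmult_comm (sin (w * y)) (/ w)).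
    exact Hd.
Qed.

Lemma cos_primitive_0 w : cos_primitive w 0 = 0.
Proof.
  unfold cos_primitive; destruct (Req_dec_T w 0); auto.
  rewrite Rmult_0_r, sin_0; field; auto.
Qed.

Lemma cos_primitive_1_le1 w : cos_primitive w 1 <= 1.
Proof.
  unfold cos_primitive; destruct (Req_dec_T w 0) as [|Hw]; [lra|]. rewrite Rmult_1_r.
  destruct (Rtotal_order w 0) as [H|[H|H]]; [|contradiction|].
  - replace (sin w / w) with (sin (- w) / - w) by (rewrite sin_neg; field; auto).
    apply Rmult_le_reg_r with (- w); [lra|].
    unfold Rdiv; rewrite Rmult_assoc, Rinv_l, Rmult_1_r, Rmult_1_l by lra.
    left; apply sin_lt_x; lra.
  - apply Rmult_le_reg_r with w; [lra|].
    unfold Rdiv; rewrite Rmult_assoc, Rinv_l, Rmult_1_r, Rmult_1_l by lra.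
    left; apply sin_lt_x; lra.
Qed.

Lemma cos_primitive_1_decay w r : 0 < r -> r <= Rabs w -> cos_primitive w 1 <= / r.
Proof.
  intros Hr Hw. unfold cos_primitive; destruct (Req_dec_T w 0) as [->|Hw0].
  { rewrite Rabs_R0 in Hw; lra. }
  rewrite Rmult_1_r. apply Rle_trans with (1 := Rle_abs _).
  unfold Rdiv; rewrite Rabs_mult, Rabs_inv.
  assert (Rabs (sin w) <= 1) by (apply Rabs_le, SIN_bound).
  assert (/ Rabs w <= / r) by (apply Rinv_le_contravar; auto).
  assert (0 < / Rabs w) by (apply Rinv_0_lt_compat; lra).
  pose proof (Rabs_pos (sin w)). nra.
Qed.

Lemma rsum_derive n (f g : nat -> R -> R) y :
  (forall i, derivable_pt_lim (f i) y (g i y)) ->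
  derivable_pt_lim (fun y => rsum n (fun i => f i y)) y (rsum n (fun i => g i y)).
Proof.
  intros H; induction n; simpl.
  - apply derivable_pt_lim_const.
  - apply (derivable_pt_lim_plus (fun y => rsum n (fun i => f i y)) (f n)); auto.
Qed.

Definition energy_primitive (h : R) (N : nat) (u : nat -> R) (y : R) : R :=
  rsum N (fun i => rsum N (fun j => cos_primitive (2 * PI * h * (u i - u j)) y)).

Lemma energy_primitive_derive h N u y :
  derivable_pt_lim (energy_primitive h N u) y (energy h N (fun i => u i * y)).
Proof.
  rewrite energy_expand. unfold energy_primitive.
  apply (rsum_derive N
    (fun i y => rsum N (fun j => cos_primitive (2 * PI * h * (u i - u j)) y))
    (fun i y => rsum N (fun j => cos (2 * PI * h * (u i * y - u j * y))))).
  intros i. apply (rsum_derive N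
    (fun j y => cos_primitive (2 * PI * h * (u i - u j)) y)
    (fun j y => cos (2 * PI * h * (u i * y - u j * y)))).
  intros j. replace (2 * PI * h * (u i * y - u j * y))
    with (2 * PI * h * (u i - u j) * y) by ring.
  apply cos_primitive_derive.
Qed.

Definition separated (k : R) (u : nat -> R) : Prop :=
  forall i j, i <> j -> Rabs (u i - u j) > k.

(** Intervals of length [k] centred at the selected points are disjoint and packed into an interval
    of length [2 r + k]. *)
Lemma separated_count k u a r N (P : nat -> bool) : 0 < k -> 0 <= r -> separated k u ->
  (forall j, (j < N)%nat -> P j = true -> Rabs (u j - a) <= r) ->
  k * INR (nsum N (fun j => Nat.b2n (P j))) <= 2 * r + k.
Proof.
  intros Hk Hr Hu HP.
  set (l := map (fun j => (u j - k / 2, u j + k / 2)) (filter P (seq 0 N))).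
  assert (Hlen : total_length l = k * INR (nsum N (fun j => Nat.b2n (P j)))).
  { unfold l. clear HP. induction N as [|N IH]; [simpl; ring|].
    rewrite seq_S, filter_app, map_app, total_length_app, IH.
    cbn [nsum]. rewrite plus_INR. simpl. destruct (P N); simpl; lra. }
  rewrite <- Hlen.
  replace (2 * r + k) with ((a + r + k / 2) - (a - r - k / 2)) by field.
  apply (total_length_packed (length l)); auto; [lra| |].
  - intros q Hq. apply in_map_iff in Hq as (j & <- & Hj).
    apply filter_In in Hj as [Hj HPj]. apply in_seq in Hj.
    assert (Hj' : Rabs (u j - a) <= r) by (apply HP; auto; lia).
    simpl. unfold Rabs in Hj'; destruct (Rcase_abs (u j - a)); lra.
  - unfold l. clear Hlen l HP.
    assert (Hnd : NoDup (filter P (seq 0 N))) by apply NoDup_filter, seq_NoDup.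
    induction Hnd as [|j l Hj Hnd IH]; simpl; auto. split; auto.
    apply Forall_forall; intros q Hq. apply in_map_iff in Hq as (i & <- & Hi).
    assert (Hij : i <> j) by congruence.
    specialize (Hu i j Hij). simpl.
    unfold Rabs in Hu; destruct (Rcase_abs (u i - u j)); lra.
Qed.

(** Here [N = q^4], and each row is split at distance [r = q^2]. At most [2 r / k + 1] near terms
    contribute at most 1 each; the far ones contribute at most [1 / r] each, hence at most
    [N / r = r] together. There are [q^4] rows of size [O(q^2)]. *)
Lemma energy_primitive_bound k u h q : 0 < k -> separated k u -> 1 <= h -> (0 < q)%nat ->
  energy_primitive h (q ^ 4) u 1 - energy_primitive h (q ^ 4) u 0
  <= INR q ^ 6 * (2 / k + 2).
Proof.
  intros Hk Hu Hh Hq. set (N := (q ^ 4)%nat).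
  assert (Hq' : 1 <= INR q) by (apply (le_INR 1); lia).
  assert (HN : INR N = INR q ^ 4) by (unfold N; apply pow_INR).
  unfold energy_primitive.
  rewrite (rsum_ext N (fun i => rsum N (fun j => cos_primitive _ 0)) (fun _ => 0)).
  2:{ intros i _. rewrite (rsum_ext N _ (fun _ => 0)), rsum_const; [ring|].
      intros; apply cos_primitive_0. }
  rewrite rsum_const.
  apply Rle_trans with (rsum N (fun _ => INR q ^ 2 * (2 / k + 2))).
  2:{ rewrite rsum_const, HN. right; ring. }
  rewrite Rmult_0_r, Rminus_0_r. apply rsum_le; intros i Hi.
  set (r := INR q ^ 2).
  assert (Hr : 1 <= r) by (unfold r; nra).
  set (P := fun j => if Rle_dec (Rabs (u j - u i)) r then true else false).
  apply Rle_trans with (rsum N (fun j => INR (Nat.b2n (P j)) + / r)).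
  - apply rsum_le; intros j _. unfold P; destruct (Rle_dec (Rabs (u j - u i)) r) as [|Hn].
    + simpl. assert (0 < / r) by (apply Rinv_0_lt_compat; lra).
      pose proof (cos_primitive_1_le1 (2 * PI * h * (u i - u j))). lra.
    + simpl. rewrite Rplus_0_l. apply cos_primitive_1_decay; [lra|].
      rewrite Rabs_mult, (Rabs_minus_sym (u i)), (Rabs_pos_eq (2 * PI * h)).
      * pose proof PI2_3_2. assert (1 <= 2 * PI * h) by nra. nra.
      * pose proof PI_RGT_0; nra.
  - rewrite rsum_plus, rsum_const, <- (INR_nsum N (fun j => Nat.b2n (P j))).
    assert (HP : k * INR (nsum N (fun j => Nat.b2n (P j))) <= 2 * r + k).
    { apply (separated_count k u (u i)); auto; [lra|].
      intros j _; unfold P; destruct (Rle_dec (Rabs (u j - u i)) r); auto; discriminate. }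
    assert (HP' : INR (nsum N (fun j => Nat.b2n (P j))) <= 2 * r / k + 1).
    { apply Rmult_le_reg_l with k; auto.
      replace (k * (2 * r / k + 1)) with (2 * r + k) by (field; lra). auto. }
    replace (INR N * / r) with r by (rewrite HN; unfold r; field; lra).
    replace (r * (2 / k + 2)) with (2 * r / k + 2 * r) by (field; lra). lra.
Qed.

(** Chebyshev's inequality with the mean value theorem in place of an integral: [G] grows over each
    cell by [E y / M] for some [y] inside it. That [y] is not controlled, so [theta <= E y] is
    demanded throughout a bad cell. *)
Lemma bad_cells_le_primitive (M : nat) (bad : nat -> bool) (E G : R -> R) theta :
  (0 < M)%nat -> 0 <= theta -> (forall y, 0 <= E y) ->
  (forall y, derivable_pt_lim G y (E y)) ->
  (forall j y, (j < M)%nat -> bad j = true ->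
     INR j / INR M <= y <= INR (S j) / INR M -> theta <= E y) ->
  INR (nsum M (fun j => Nat.b2n (bad j))) * theta <= INR M * (G 1 - G 0).
Proof.
  intros HM Hth HE HG Hbad. pose proof (lt_0_INR _ HM) as HM'.
  assert (H : forall t, (t <= M)%nat ->
    INR (nsum t (fun j => Nat.b2n (bad j))) * theta <= INR M * (G (INR t / INR M) - G 0)).
  { induction t as [|t IH]; intros Ht.
    - simpl. unfold Rdiv; rewrite !Rmult_0_l. right; ring.
    - specialize (IH ltac:(lia)). cbn [nsum]. rewrite plus_INR.
      destruct (MVT_cor2 G E (INR t / INR M) (INR (S t) / INR M)) as (y & Hy & Hyb).
      + apply div_INR_lt; auto.
      + intros; apply HG.
      + assert (Hstep : INR M * (G (INR (S t) / INR M) - G (INR t / INR M)) = E y).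
        { rewrite Hy, S_INR. field; lra. }
        assert (INR (Nat.b2n (bad t)) * theta <= E y).
        { destruct (bad t) eqn:Eb; cbn [Nat.b2n].
          - simpl INR. rewrite Rmult_1_l. apply (Hbad t); auto. lra.
          - simpl INR. rewrite Rmult_0_l. auto. }
        lra. }
  specialize (H M (Nat.le_refl M)).
  replace (INR M / INR M) with 1 in H by (field; lra). exact H.
Qed.

Lemma energetic_cells_few k u n q M (bad : nat -> bool) theta :
  0 < k -> separated k u -> (0 < q)%nat -> (0 < M)%nat -> 0 <= theta ->
  (forall j y, (j < M)%nat -> bad j = true ->
     INR j / INR M <= y <= INR (S j) / INR M ->
     theta <= rsum n (fun m => energy (INR (S m)) (q ^ 4) (fun i => u i * y))) ->
  INR (nsum M (fun j => Nat.b2n (bad j))) * theta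
  <= INR M * (INR n * (INR q ^ 6 * (2 / k + 2))).
Proof.
  intros Hk Hu Hq HM Hth Hbad.
  set (G := fun y => rsum n (fun m => energy_primitive (INR (S m)) (q ^ 4) u y)).
  apply Rle_trans with (INR M * (G 1 - G 0)).
  - apply bad_cells_le_primitive with
      (E := fun y => rsum n (fun m => energy (INR (S m)) (q ^ 4) (fun i => u i * y))); auto.
    + intros y; apply rsum_nonneg; intros; apply energy_nonneg.
    + intros y. apply (rsum_derive n
        (fun m y => energy_primitive (INR (S m)) (q ^ 4) u y)
        (fun m y => energy (INR (S m)) (q ^ 4) (fun i => u i * y))).
      intros m; apply energy_primitive_derive.
  - apply Rmult_le_compat_l; [apply pos_INR|].
    rewrite <- rsum_const. unfold G.
    replace (rsum n (fun m => energy_primitive (INR (S m)) (q ^ 4) u 1) -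
      rsum n (fun m => energy_primitive (INR (S m)) (q ^ 4) u 0)) with
      (rsum n (fun m => energy_primitive (INR (S m)) (q ^ 4) u 1 +
        -1 * energy_primitive (INR (S m)) (q ^ 4) u 0))
      by (rewrite rsum_plus, rsum_scal; ring).
    apply rsum_le; intros m _.
    assert (1 <= INR (S m)) by (apply (le_INR 1); lia).
    pose proof (energy_primitive_bound k u (INR (S m)) q Hk Hu H Hq). lra.
Qed.

(** * Counting hits at grid points *)

Definition num_code (e : nat) : nat := fst (Cantor.of_nat e).
Definition den_code (e : nat) : nat := S (snd (Cantor.of_nat e)).

Lemma computable1_den_code : computable1 den_code.
Proof.
  apply computable1_of. unfold den_code.
  apply (computable_on_comp1 1 S), (computable_on_comp1 1 (fun e => snd (Cantor.of_nat e)));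
    auto using computable1_S, computable1_snd_of_nat, computable_on_var.
Qed.

(* The absolute value of the integer coded by [a] is [div2 (S a)]; modulo [D], its
   negative is its product with [D - 1]. *)
Definition positive_residue (a D : nat) : nat :=
  (Nat.div2 (S a) *
   (Nat.b2n (Nat.even a) + (1 - Nat.b2n (Nat.even a)) * (D - 1)))%nat.

Lemma computable2_positive_residue : computable2 positive_residue.
Proof.
  set (ev := fun a => Nat.b2n (Nat.even a)).
  assert (Hev : computable1 ev) by exact computable1_even.
  apply computable2_of.
  change positive_residue with
    (fun a D => (Nat.div2 (S a) * (ev a + (1 - ev a) * (D - 1)))%nat).
  cbv beta. computable.
Qed.

Lemma positive_residue_congr e j M : (0 < M)%nat ->
  exists t : Z,
    INR (positive_residue (num_code e) (den_code e * M) * j) / INR (den_code e * M)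
    = Q2R (Q_of_code e) * (INR j / INR M) + IZR t.
Proof.
  intros HM. pose proof (lt_0_INR _ HM) as HM'.
  unfold num_code, den_code, Q_of_code.
  destruct (Cantor.of_nat e) as [a b]; cbn [fst snd].
  assert (Hb : 0 < INR (S b)) by (apply lt_0_INR; lia).
  unfold Q2R; cbn [Qnum Qden].
  replace (IZR (Z.pos (Pos.of_succ_nat b))) with (INR (S b))
    by (rewrite INR_IZR_INZ; f_equal; lia).
  unfold positive_residue, Z_of_code.
  pose proof (Nat.div2_odd (S a)) as H1. pose proof (Nat.div2_odd a) as H2.
  rewrite Nat.odd_succ in H1. unfold Nat.odd in H2. destruct (Nat.even a) eqn:Ea.
  - exists 0%Z. cbn [Nat.b2n negb] in *.
    replace (Nat.div2 (S a)) with (Nat.div2 a) by lia.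
    change (1 - 1)%nat with 0%nat. rewrite Nat.mul_0_l, Nat.add_0_r.
    rewrite <- INR_IZR_INZ, !mult_INR.
    simpl (INR 1). field; lra.
  - cbn [Nat.b2n negb] in *.
    replace (Nat.div2 (S a)) with (S (Nat.div2 a)) by lia.
    set (c := S (Nat.div2 a)). exists (Z.of_nat (c * j)).
    rewrite opp_IZR, <- !INR_IZR_INZ, !mult_INR.
    change (1 - 0)%nat with 1%nat. rewrite Nat.mul_1_l, Nat.add_0_l, minus_INR by nia.
    rewrite mult_INR. simpl (INR 1). field; lra.
Qed.

(** The code itself is thus a computable bound on the multiplier, from which the mesh is chosen. *)
Lemma Q_of_code_abs_le e : Rabs (Q2R (Q_of_code e)) <= INR e.
Proof.
  unfold Q_of_code. rewrite <- (Cantor.cancel_to_of e) at 2.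
  destruct (Cantor.of_nat e) as [a b].
  unfold Q2R; cbn [Qnum Qden].
  assert (Ha : (a <= Cantor.to_nat (a, b))%nat).
  { rewrite to_nat_tri. pose proof (le_tri (a + b)); lia. }
  apply le_INR in Ha.
  assert (Hz : Rabs (IZR (Z_of_code a)) <= INR a).
  { rewrite <- abs_IZR, INR_IZR_INZ. apply IZR_le. unfold Z_of_code.
    pose proof (Nat.div2_odd a) as H2. unfold Nat.odd in H2.
    destruct (Nat.even a); cbn [Nat.b2n negb] in H2; lia. }
  assert (Hb : 1 <= IZR (Z.pos (Pos.of_succ_nat b))) by (apply IZR_le; lia).
  rewrite Rabs_mult, Rabs_inv, (Rabs_pos_eq (IZR (Z.pos _))) by lra.
  assert (0 < / IZR (Z.pos (Pos.of_succ_nat b)) <= 1).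
  { split; [apply Rinv_0_lt_compat; lra|].
    rewrite <- Rinv_1. apply Rinv_le_contravar; lra. }
  pose proof (Rabs_pos (IZR (Z_of_code a))). nra.
Qed.

(* [X / (D * L)] lies at most [w / L] above an integer. *)
Definition arc_hit (L w X D : nat) : bool :=
  (1 <=? nsum (S X) (fun z =>
     Nat.b2n (z * (D * L) <=? X) * Nat.b2n (X <=? z * (D * L) + w * D)))%nat.

Definition sample_hit (L s w e M j : nat) : bool :=
  arc_hit L w
    (positive_residue (num_code e) (den_code e * M) * j * L + s * (den_code e * M))
    (den_code e * M).

Lemma nsum_pos n f : (1 <= nsum n f)%nat <-> exists i, (i < n)%nat /\ (1 <= f i)%nat.
Proof.
  induction n as [|n IH]; simpl.
  - split; [lia|intros (i & ? & _); lia].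
  - split.
    + intros H. destruct (Nat.eq_dec (f n) 0) as [E|].
      * destruct (proj1 IH) as (i & ? & ?); [lia|]. exists i; lia.
      * exists n; lia.
    + intros (i & Hi & Hf). destruct (Nat.eq_dec i n) as [->|]; [lia|].
      assert (1 <= nsum n f)%nat by (apply IH; exists i; lia). lia.
Qed.

Lemma arc_hit_spec L w X D : (0 < L)%nat -> (0 < D)%nat ->
  arc_hit L w X D = true <->
  in_arc 0 (INR w / INR L) (INR X / INR (D * L)).
Proof.
  intros HL HD. pose proof (lt_0_INR _ HL). pose proof (lt_0_INR _ HD).
  assert (HX0 : 0 <= INR X / INR (D * L)).
  { apply Rmult_le_pos; [apply pos_INR|]. left; apply Rinv_0_lt_compat.
    rewrite mult_INR; apply Rmult_lt_0_compat; auto. }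
  assert (E : forall z : nat,
    (z * (D * L) <= X /\ X <= z * (D * L) + w * D)%nat <->
    0 <= INR X / INR (D * L) - INR z <= 0 + INR w / INR L).
  { intros z.
    assert (E1 : INR X / INR (D * L) - INR z = (INR X - INR (z * (D * L))) / INR (D * L)).
    { rewrite !mult_INR; field; lra. }
    assert (E2 : 0 + INR w / INR L = INR (w * D) / INR (D * L)).
    { rewrite !mult_INR; field; lra. }
    rewrite E1, E2.
    assert (P : 0 < / INR (D * L)).
    { apply Rinv_0_lt_compat. rewrite mult_INR; apply Rmult_lt_0_compat; auto. }
    split.
    - intros [H1 H2]. apply le_INR in H1, H2. rewrite plus_INR in H2. split.
      + apply Rmult_le_pos; lra.
      + apply Rmult_le_compat_r; lra.
    - intros [H1 H2]. unfold Rdiv in *.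
      apply Rmult_le_reg_r in H2; auto.
      rewrite <- (Rmult_0_l (/ INR (D * L))) in H1. apply Rmult_le_reg_r in H1; auto.
      split; apply INR_le; rewrite ?plus_INR; lra. }
  unfold arc_hit. rewrite Nat.leb_le, nsum_pos. split.
  - intros (z & _ & Hz). exists (Z.of_nat z). rewrite <- INR_IZR_INZ. apply E.
    destruct (Nat.leb_spec (z * (D * L)) X); cbn [Nat.b2n] in Hz; [|lia].
    destruct (Nat.leb_spec X (z * (D * L) + w * D)); cbn [Nat.b2n] in Hz; [lia|lia].
  - intros [z Hz].
    (* The search runs over natural [z]. As the value is non-negative, a negative integer that
       witnesses the arc can be replaced by 0. *)
    assert (Hz' : 0 <= INR X / INR (D * L) - INR (Z.to_nat z) <= 0 + INR w / INR L).
    { destruct (Z_le_gt_dec 0 z).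
      - rewrite (INR_IZR_INZ (Z.to_nat z)), Z2Nat.id; auto.
      - replace (Z.to_nat z) with 0%nat by lia. assert (IZR z <= -1) by (apply IZR_le; lia).
        simpl (INR 0). lra. }
    apply E in Hz'. exists (Z.to_nat z). split.
    + assert (HDL : (1 <= D * L)%nat) by nia. apply Nat.lt_succ_r.
      apply Nat.le_trans with (2 := proj1 Hz').
      rewrite <- (Nat.mul_1_r (Z.to_nat z)) at 1. apply Nat.mul_le_mono_l, HDL.
    + destruct (Nat.leb_spec (Z.to_nat z * (D * L)) X); [|lia].
      destruct (Nat.leb_spec X (Z.to_nat z * (D * L) + w * D)); simpl; lia.
Qed.

Lemma in_arc_shift c w y a (t : Z) :
  in_arc (c + a) w (y + a + IZR t) <-> in_arc c w y.
Proof.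
  split; intros [z Hz].
  - exists (z - t)%Z. rewrite minus_IZR. lra.
  - exists (z + t)%Z. rewrite plus_IZR. lra.
Qed.

Lemma in_arc_widen c w y y' d : in_arc c w y -> Rabs (y - y') <= d ->
  in_arc (c - d) (w + 2 * d) y'.
Proof.
  intros [z Hz] Hd. exists z.
  unfold Rabs in Hd; destruct (Rcase_abs (y - y')); lra.
Qed.

(** The shift by [(L - p + 1) / L] carries the start [(p - 1) / L] of the arc to the integer 1; the
    extra full turn keeps the shift a natural number of units [1/L]. *)
Lemma sample_hit_spec L p w e M j : (0 < L)%nat -> (0 < M)%nat -> (p <= L)%nat ->
  sample_hit L (L - p + 1) w e M j = true <->
  in_arc ((INR p - 1) / INR L) (INR w / INR L) (Q2R (Q_of_code e) * (INR j / INR M)).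
Proof.
  intros HL HM Hp. pose proof (lt_0_INR _ HL). pose proof (lt_0_INR _ HM).
  unfold sample_hit.
  assert (HD : (0 < den_code e * M)%nat) by (unfold den_code; nia).
  rewrite arc_hit_spec by auto.
  destruct (positive_residue_congr e j M HM) as [t Ht].
  set (D := (den_code e * M)%nat) in *. pose proof (lt_0_INR _ HD).
  set (A := (positive_residue (num_code e) D * j)%nat) in *.
  replace (INR (A * L + (L - p + 1) * D) / INR (D * L))
    with (INR A / INR D + (INR L - INR p + 1) / INR L).
  2:{ rewrite !plus_INR, !mult_INR, plus_INR, minus_INR by auto. simpl (INR 1). field; lra. }
  rewrite Ht.
  replace (Q2R (Q_of_code e) * (INR j / INR M) + IZR t + (INR L - INR p + 1) / INR L)
    with (Q2R (Q_of_code e) * (INR j / INR M) + (1 - INR p) / INR L + IZR (t + 1))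
    by (rewrite plus_IZR; field; lra).
  replace 0 with ((INR p - 1) / INR L + (1 - INR p) / INR L) at 1 by (field; lra).
  apply in_arc_shift.
Qed.

Lemma computable2_hit_count L s w f NN M :
  computable1 f -> computable1 NN -> computable1 M ->
  computable2 (fun m j =>
    nsum (NN m) (fun i => Nat.b2n (sample_hit L s w (f i) (M m) j))).
Proof.
  intros Hf HNN HM. pose proof computable1_den_code.
  assert (Hnum : computable1 num_code) by exact computable1_fst_of_nat.
  pose proof computable2_positive_residue.
  apply computable2_of. unfold sample_hit, arc_hit.
  computable.
Qed.

Lemma computable2_ltb F G : computable2 F -> computable2 G ->
  computable2 (fun m j => Nat.b2n (F m j <? G m j)%nat).
Proof. intros HF HG. apply computable2_of. unfold Nat.ltb. computable. Qed.

(** * Uniform distribution *)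

Lemma computable1_fourth_power C : computable1 (fun m => ((C * S m) ^ 4)%nat).
Proof.
  apply computable1_of.
  apply computable_on_ext with (fun l => let q := (C * S (nth 0 l 0))%nat in
    (q * (q * (q * (q * 1))))%nat); [intros; reflexivity|].
  cbv zeta. computable.
Qed.

Lemma nsum_le_mono n f g : (forall i, (i < n)%nat -> (f i <= g i)%nat) ->
  (nsum n f <= nsum n g)%nat.
Proof. induction n; simpl; intros H; auto. apply Nat.add_le_mono; auto. Qed.

Lemma nsum_term_le n f i : (i < n)%nat -> (f i <= nsum n f)%nat.
Proof.
  induction n; simpl; intros H; [lia|].
  destruct (Nat.eq_dec i n) as [->|]; [lia|]. assert (f i <= nsum n f)%nat by (apply IHn; lia). lia.
Qed.

Lemma nsum_le_length n f n' : (n <= n')%nat -> (nsum n f <= nsum n' f)%nat.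
Proof. induction 1; simpl; lia. Qed.

Lemma Rabs_mult_cell a y M j L : (0 < L)%nat -> (0 < M)%nat ->
  INR L * Rabs a <= INR M -> INR j / INR M <= y <= INR (S j) / INR M ->
  Rabs (a * (INR j / INR M) - a * y) <= / INR L.
Proof.
  intros HL HM Ha Hy. pose proof (lt_0_INR _ HL). pose proof (lt_0_INR _ HM).
  rewrite <- Rmult_minus_distr_l, Rabs_mult.
  assert (Hd : Rabs (INR j / INR M - y) <= / INR M).
  { rewrite S_INR in Hy. replace ((INR j + 1) / INR M) with (INR j / INR M + / INR M) in Hy
      by (field; lra).
    apply Rabs_le; lra. }
  apply Rle_trans with (Rabs a * / INR M).
  - apply Rmult_le_compat_l; auto; apply Rabs_pos.
  - apply Rmult_le_reg_l with (INR L * INR M); [apply Rmult_lt_0_compat; auto|].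
    replace (INR L * INR M * (Rabs a * / INR M)) with (INR L * Rabs a) by (field; lra).
    replace (INR L * INR M * / INR L) with (INR M) by (field; lra). auto.
Qed.

(** Widths in units of [1/L]: [r - p] for hits at [x], [+ 2] for hits at the sample point of its
    cell, [+ 4] for hits at any point of that cell, and one more unit as the excess that forces a
    large exponential sum, hence [+ 5]. *)
Lemma schnorr_arc_bound_fourth_powers x f k L p r :
  0 <= x <= 1 -> schnorr_random x -> computable1 f ->
  0 < k -> separated k (fun i => Q2R (Q_of_code (f i))) ->
  (0 < L)%nat -> (p <= r <= L)%nat ->
  exists C N0, (0 < C)%nat /\ forall m B, (N0 <= m)%nat ->
    (forall i, B i = true ->
       in_arc (INR p / INR L) (INR (r - p) / INR L) (Q2R (Q_of_code (f i)) * x)) ->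
    (nsum ((C * S m) ^ 4) (fun i => Nat.b2n (B i)) * L <= (C * S m) ^ 4 * (r - p + 5))%nat.
Proof.
  intros Hx Hrand Hf Hk Hsep HL Hpr.
  set (u := fun i => Q2R (Q_of_code (f i))) in *.
  pose proof (lt_0_INR _ HL) as HL'.
  destruct (crowded_arc_energy ((INR p - 2) / INR L) (INR (r - p + 4) / INR L) (/ INR L))
    as (n & c0 & Hc0 & Hcrowd).
  { apply Rmult_le_pos; [apply pos_INR|]. left; apply Rinv_0_lt_compat; auto. }
  { apply Rinv_0_lt_compat; auto. }
  set (K := INR n * (2 / k + 2)).
  assert (HK : 0 <= K).
  { apply Rmult_le_pos; [apply pos_INR|].
    assert (0 < 2 / k) by (apply Rdiv_lt_0_compat; lra). lra. }
  (* With [q = C (m+1)] the proportion of bad cells is at most [K / (c0 q^2)]. This [C] makes it at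
     most [1 / (2 (m+1)^2)], which is below [1 / ((m+1)(m+2))]. *)
  destruct (nat_floor (2 * K / c0)) as (C0 & _ & HC0).
  { apply Rmult_le_pos; [lra|]. left; apply Rinv_0_lt_compat; auto. }
  set (C := S C0) in *.
  assert (HC : 2 * K <= c0 * INR C ^ 2).
  { assert (1 <= INR C) by (apply (le_INR 1); unfold C; lia).
    assert (2 * K <= c0 * INR C).
    { apply Rmult_le_reg_r with (/ c0); [apply Rinv_0_lt_compat; auto|].
      replace (c0 * INR C * / c0) with (INR C) by (field; lra).
      fold C in HC0. unfold Rdiv in HC0; lra. }
    nra. }
  set (NN := fun m => ((C * S m) ^ 4)%nat).
  (* [W m] exceeds [L |u_i|] for every [i < NN m], so across one cell each [u_i y] moves by at most
     [1/L]. The successor keeps [W m] positive. *)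
  set (W := fun m => (L * S (nsum (NN m) (fun i => f i)))%nat).
  set (M := grid_size W).
  set (bad := fun m j => (NN m * (r - p + 5) <?
    nsum (NN m) (fun i => Nat.b2n (sample_hit L (L - p + 1) (r - p + 2) (f i) (M m) j)) * L)%nat).
  assert (HNN : computable1 NN) by apply computable1_fourth_power.
  assert (HW : computable1 W).
  { apply computable1_of. unfold W. computable. }
  assert (HW0 : forall m, (0 < W m)%nat) by (intros m; unfold W; nia).
  assert (HMW : forall m, (W m <= M m)%nat) by (intros m; unfold M, grid_size; nia).
  assert (HM0 : forall m, (0 < M m)%nat).
  { intros m. specialize (HW0 m); specialize (HMW m); lia. }
  assert (Hmesh : forall m i, (i < NN m)%nat -> INR L * Rabs (u i) <= INR (M m)).
  { intros m i Hi. apply Rle_trans with (INR (L * f i)).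
    - rewrite mult_INR. apply Rmult_le_compat_l; [lra|]. apply Q_of_code_abs_le.
    - apply le_INR. apply Nat.le_trans with (2 := HMW m). unfold W.
      apply Nat.mul_le_mono_l. pose proof (nsum_term_le (NN m) (fun i => f i) i Hi). lia. }
  destruct (schnorr_random_good_cell x W bad) as [N0 HN0]; auto.
  - assert (Hcnt : computable2 (fun m j => nsum (NN m)
      (fun i => Nat.b2n (sample_hit L (L - p + 1) (r - p + 2) (f i) (M m) j)))).
    { apply computable2_hit_count; auto. apply computable1_grid_size; auto. }
    set (cnt := fun m j => nsum (NN m)
      (fun i => Nat.b2n (sample_hit L (L - p + 1) (r - p + 2) (f i) (M m) j))) in *.
    apply (computable2_ltb (fun m j => (NN m * (r - p + 5))%nat)
      (fun m j => (cnt m j * L)%nat)); apply computable2_of.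
    + set (c := (r - p + 5)%nat). computable.
    + computable.
  - intros m. fold M.
    set (q := (C * S m)%nat).
    assert (Hq : (0 < q)%nat) by (unfold q, C; nia).
    assert (Hq' : 0 < INR q) by (apply lt_0_INR; auto).
    pose proof (energetic_cells_few k u n q (M m) (bad m) (c0 * Rsqr (INR (q ^ 4)))) as Hfew.
    assert (HMm : 0 < INR (M m)) by (apply lt_0_INR; auto).
    assert (Hcount : INR (nsum (M m) (fun j => Nat.b2n (bad m j))) * (c0 * Rsqr (INR (q ^ 4)))
      <= INR (M m) * (INR n * (INR q ^ 6 * (2 / k + 2)))).
    { apply Hfew; auto.
      - apply Rmult_le_pos; [lra|apply Rle_0_sqr].
      - intros j y Hj Hbad Hy.
        apply (Hcrowd (q ^ 4)%nat (fun i => u i * y)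
          (fun i => sample_hit L (L - p + 1) (r - p + 2) (f i) (M m) j)).
        (* The hits decided at [j / M] are carried to an arbitrary [y] of the cell, so one and the
           same selection is crowded at all its points. *)
        + intros i Hi Hhit. apply sample_hit_spec in Hhit; auto; [|lia].
          apply in_arc_widen with (y' := u i * y) (d := / INR L) in Hhit.
          * replace ((INR p - 2) / INR L) with ((INR p - 1) / INR L - / INR L)
              by (field; lra).
            replace (INR (r - p + 4) / INR L) with (INR (r - p + 2) / INR L + 2 * / INR L).
            -- exact Hhit.
            -- rewrite !plus_INR. simpl (INR 2); simpl (INR 4). field; lra.
          * apply (Rabs_mult_cell (u i) y (M m) j L); auto.
        + unfold bad in Hbad. apply Nat.ltb_lt in Hbad. apply lt_INR in Hbad.
          rewrite !mult_INR in Hbad.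
          apply Rmult_lt_reg_r with (INR L); auto.
          replace (INR (q ^ 4) * (INR (r - p + 4) / INR L + / INR L) * INR L)
            with (INR (NN m) * INR (r - p + 5)).
          * exact Hbad.
          * unfold NN. fold q. rewrite !plus_INR. simpl (INR 4); simpl (INR 5). field; lra. }
    clear Hfew.
    set (b := INR (nsum (M m) (fun j => Nat.b2n (bad m j)))) in *.
    assert (Eq4 : Rsqr (INR (q ^ 4)) = INR q ^ 6 * INR q ^ 2).
    { rewrite pow_INR. unfold Rsqr; ring. }
    assert (Hb0 : 0 <= b) by apply pos_INR.
    rewrite Eq4 in Hcount.
    assert (H1 : b * (c0 * INR q ^ 2) <= INR (M m) * K).
    { apply Rmult_le_reg_l with (INR q ^ 6); [apply pow_lt; auto|]. unfold K. lra. }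
    set (m1 := INR (S m)).
    assert (Hm1 : 1 <= m1) by (apply (le_INR 1); lia).
    assert (Eq : INR q ^ 2 = INR C ^ 2 * m1 ^ 2) by (unfold q; rewrite mult_INR; unfold m1; ring).
    assert (EM : INR (M m) = m1 * (m1 + 1) * INR (W m)).
    { unfold M, grid_size. rewrite !mult_INR, (S_INR (S m)). reflexivity. }
    rewrite Eq, EM in H1.
    assert (HWm : 0 < INR (W m)) by (apply lt_0_INR; auto).
    apply INR_le. fold b.
    (* [K] vanishes only if no frequency is used ([n = 0]); then the estimate says that no cell is
       bad. *)
    destruct (Rle_lt_dec K 0) as [HK0|HK0].
    + assert (HKz : K = 0) by lra. rewrite HKz, Rmult_0_r in H1.
      assert (0 < c0 * (INR C ^ 2 * m1 ^ 2)).
      { apply Rmult_lt_0_compat; auto. apply Rmult_lt_0_compat; apply pow_lt; [|lra].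
        apply lt_0_INR; unfold C; lia. }
      nra.
    + apply Rmult_le_reg_l with (2 * K * m1 ^ 2).
      { apply Rmult_lt_0_compat; [lra|apply pow_lt; lra]. }
      apply Rle_trans with (b * (c0 * (INR C ^ 2 * m1 ^ 2))).
      * replace (2 * K * m1 ^ 2 * b) with (b * m1 ^ 2 * (2 * K)) by ring.
        replace (b * (c0 * (INR C ^ 2 * m1 ^ 2))) with (b * m1 ^ 2 * (c0 * INR C ^ 2)) by ring.
        apply Rmult_le_compat_l; auto. apply Rmult_le_pos; auto. apply pow_le; lra.
      * apply Rle_trans with (1 := H1).
        replace (2 * K * m1 ^ 2 * INR (W m)) with (m1 * (2 * m1) * INR (W m) * K) by ring.
        apply Rmult_le_compat_r; auto. apply Rmult_le_compat_r; [lra|].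
        apply Rmult_le_compat_l; lra.
  - exists C, N0; split; [unfold C; lia|]. intros m B Hm HB.
    destruct (HN0 m Hm) as (j & Hj & Hxj & Hgood). fold M in Hxj.
    unfold bad in Hgood. apply Nat.ltb_ge in Hgood.
    apply Nat.le_trans with (2 := Hgood). apply Nat.mul_le_mono_r.
    apply nsum_le_mono; intros i Hi.
    destruct (B i) eqn:EB; [|simpl; lia].
    specialize (HB i EB). fold (u i) in HB.
    assert (Hhit : sample_hit L (L - p + 1) (r - p + 2) (f i) (M m) j = true).
    { apply sample_hit_spec; auto; [lia|].
      apply in_arc_widen with (y' := u i * (INR j / INR (M m))) (d := / INR L) in HB.
      - replace ((INR p - 1) / INR L) with (INR p / INR L - / INR L) by (field; lra).
        replace (INR (r - p + 2) / INR L) with (INR (r - p) / INR L + 2 * / INR L).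
        + exact HB.
        + rewrite plus_INR. simpl (INR 2). field; lra.
      - rewrite Rabs_minus_sym. apply (Rabs_mult_cell (u i) x (M m) j L); auto. }
    rewrite Hhit; auto.
Qed.

Lemma fourth_power_between C N0 N : (0 < C)%nat -> ((C * S N0) ^ 4 <= N)%nat ->
  exists m, (N0 <= m)%nat /\ ((C * S m) ^ 4 <= N < (C * S (S m)) ^ 4)%nat.
Proof.
  intros HC HN.
  induction N as [|N IH].
  - exfalso. assert (0 < (C * S N0) ^ 4)%nat by (apply Nat.neq_0_lt_0, Nat.pow_nonzero; nia). lia.
  - destruct (Nat.eq_dec ((C * S N0) ^ 4) (S N)) as [E|E].
    + exists N0. split; auto. split; auto. rewrite <- E. apply Nat.pow_lt_mono_l; nia.
    + destruct IH as (m & Hm & H1 & H2); [lia|].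
      destruct (Nat.eq_dec (S N) ((C * S (S m)) ^ 4)) as [E'|].
      * exists (S m). split; [lia|]. split; [lia|]. rewrite E'. apply Nat.pow_lt_mono_l; nia.
      * exists m. lia.
Qed.

(** The count grows with [N], so it is bounded by its value at the next fourth power; the ratio of
    consecutive ones tends to 1, and the loss is absorbed by one more unit of [1/L]. *)
Lemma schnorr_arc_bound x f k L p r :
  0 <= x <= 1 -> schnorr_random x -> computable1 f ->
  0 < k -> separated k (fun i => Q2R (Q_of_code (f i))) ->
  (0 < L)%nat -> (p <= r <= L)%nat ->
  forall B, (forall i, B i = true ->
       in_arc (INR p / INR L) (INR (r - p) / INR L) (Q2R (Q_of_code (f i)) * x)) ->
  exists N1, forall N, (N1 <= N)%nat ->
    (nsum N (fun i => Nat.b2n (B i)) * L <= N * (r - p + 6))%nat.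
Proof.
  intros Hx Hrand Hf Hk Hsep HL Hpr B HB.
  destruct (schnorr_arc_bound_fourth_powers x f k L p r) as (C & N0 & HC & H); auto.
  set (a := (r - p + 5)%nat) in *.
  (* [15 = 4 + 6 + 4 + 1] bounds the lower terms of [(t+1)^4] by [15 t^3], and [t >= 15 a] makes
     [15 t^3 a] at most [t^4]. *)
  exists ((C * S (N0 + 15 * a)) ^ 4)%nat. intros N HN.
  destruct (fourth_power_between C (N0 + 15 * a) N HC HN) as (m & Hm & Hm1 & Hm2).
  apply Nat.le_trans with (nsum ((C * S (S m)) ^ 4) (fun i => Nat.b2n (B i)) * L)%nat.
  { apply Nat.mul_le_mono_r, nsum_le_length; lia. }
  apply Nat.le_trans with ((C * S (S m)) ^ 4 * a)%nat.
  { apply H; auto; lia. }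
  replace (r - p + 6)%nat with (a + 1)%nat by (unfold a; lia).
  apply Nat.le_trans with ((C * S m) ^ 4 * (a + 1))%nat; [|apply Nat.mul_le_mono_r; auto].
  rewrite !Nat.pow_mul_l, <- !Nat.mul_assoc. apply Nat.mul_le_mono_l.
  set (t := S m). assert (Ht : (15 * a <= t)%nat) by (unfold t; lia).
  assert (Ht1 : (1 <= t)%nat) by (unfold t; lia).
  assert (E : (S t ^ 4 <= t ^ 4 + 15 * t ^ 3)%nat).
  { assert (t <= t * t)%nat by nia. assert (t * t <= t * t * t)%nat by nia.
    replace (S t ^ 4)%nat with
      (t ^ 4 + (4 * (t * t * t) + 6 * (t * t) + 4 * t + 1))%nat by (cbn [Nat.pow]; ring).
    replace (t ^ 3)%nat with (t * t * t)%nat by (cbn [Nat.pow]; ring). lia. }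
  apply Nat.le_trans with ((t ^ 4 + 15 * t ^ 3) * a)%nat; [apply Nat.mul_le_mono_r; auto|].
  replace ((t ^ 4 + 15 * t ^ 3) * a)%nat with (t ^ 4 * a + t ^ 3 * (15 * a))%nat by ring.
  replace (t ^ 4 * (a + 1))%nat with (t ^ 4 * a + t ^ 3 * t)%nat by (cbn [Nat.pow]; ring).
  apply Nat.add_le_mono_l, Nat.mul_le_mono_l; auto.
Qed.

Lemma count_in_nsum y u v N :
  count_in y u v N =
  nsum N (fun i => Nat.b2n (in_interval_b u v (frac_part (y i)) =? 1)%nat).
Proof.
  induction N as [|N IH]; simpl; auto. rewrite IH. f_equal.
  unfold in_interval_b. destruct (Rle_dec _ _); auto; destruct (Rle_dec _ _); auto.
Qed.

(** The interval is rounded outwards to multiples of [1/L], the right end through the floor of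
    [(1 - v) L]. Rounding costs at most two units and the arc bound six, hence [8 / L < eps]. *)
Lemma schnorr_interval_bound x f k u v eps :
  0 <= x <= 1 -> schnorr_random x -> computable1 f ->
  0 < k -> separated k (fun i => Q2R (Q_of_code (f i))) ->
  0 <= u -> u <= v -> v <= 1 -> 0 < eps ->
  exists N1, forall N, (N1 <= N)%nat ->
    INR (count_in (fun n => Q2R (Q_of_code (f n)) * x) u v N) <= INR N * (v - u + eps).
Proof.
  intros Hx Hrand Hf Hk Hsep Hu Huv Hv Heps.
  destruct (archimed_cor1 (eps / 8)) as (L & HLe & HL); [lra|].
  pose proof (lt_0_INR _ HL) as HL'.
  destruct (nat_floor (u * INR L)) as (p & Hp1 & Hp2); [apply Rmult_le_pos; lra|].
  destruct (nat_floor ((1 - v) * INR L)) as (r' & Hr1 & Hr2); [apply Rmult_le_pos; lra|].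
  assert (Hr'L : (r' <= L)%nat) by (apply INR_le; nra).
  set (r := (L - r')%nat).
  assert (Er : INR r = INR L - INR r') by (unfold r; apply minus_INR; auto).
  assert (Hpr : (p <= r)%nat) by (apply INR_le; nra).
  set (y := fun n => Q2R (Q_of_code (f n)) * x).
  destruct (schnorr_arc_bound x f k L p r Hx Hrand Hf Hk Hsep HL ltac:(lia)
    (fun i => (in_interval_b u v (frac_part (y i)) =? 1)%nat)) as [N1 HN1].
  { intros i Hi. unfold in_interval_b in Hi.
    destruct (Rle_dec u (frac_part (y i))) as [H1|]; [|discriminate].
    destruct (Rle_dec (frac_part (y i)) v) as [H2|]; [|discriminate].
    exists (Int_part (y i)). fold (y i). unfold frac_part in H1, H2.
    rewrite minus_INR by auto. rewrite Er.
    assert (INR p / INR L <= u).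
    { apply Rmult_le_reg_r with (INR L); auto.
      replace (INR p / INR L * INR L) with (INR p) by (field; lra). auto. }
    assert (v <= INR p / INR L + (INR L - INR r' - INR p) / INR L).
    { apply Rmult_le_reg_r with (INR L); auto.
      replace ((INR p / INR L + (INR L - INR r' - INR p) / INR L) * INR L)
        with (INR L - INR r') by (field; lra). lra. }
    lra. }
  exists N1; intros N HN. specialize (HN1 N HN).
  rewrite <- count_in_nsum in HN1. apply le_INR in HN1.
  rewrite !mult_INR, plus_INR, minus_INR, Er in HN1 by auto. simpl (INR 6) in HN1.
  pose proof (pos_INR N). rewrite !S_INR in *.
  apply Rmult_le_reg_r with (INR L); auto. apply Rle_trans with (1 := HN1).
  rewrite Rmult_assoc. apply Rmult_le_compat_l; auto.
  assert (8 < eps * INR L).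
  { apply Rmult_lt_reg_r with (/ INR L); [apply Rinv_0_lt_compat; auto|].
    rewrite Rmult_assoc, Rinv_r by lra. lra. }
  lra.
Qed.

(** This turns upper bounds on the two outer intervals into a lower bound on the middle one. Shared
    endpoints may be counted twice, so only an inequality holds, in the direction needed. *)
Lemma count_in_cover y u v N : 0 <= u -> v <= 1 ->
  (N <= count_in y 0 u N + count_in y u v N + count_in y v 1 N)%nat.
Proof.
  intros Hu Hv. induction N as [|N IH]; simpl; auto.
  destruct (base_fp (y N)) as [H0 H1].
  assert (1 <= in_interval_b 0 u (frac_part (y N)) + in_interval_b u v (frac_part (y N))
    + in_interval_b v 1 (frac_part (y N)))%nat; [|lia].
  unfold in_interval_b.
  destruct (Rle_dec 0 (frac_part (y N))); [|lra].
  destruct (Rle_dec (frac_part (y N)) u); [lia|].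
  destruct (Rle_dec u (frac_part (y N))); [|lra].
  destruct (Rle_dec (frac_part (y N)) v); [lia|].
  destruct (Rle_dec v (frac_part (y N))); [|lra].
  destruct (Rle_dec (frac_part (y N)) 1); [lia|lra].
Qed.

Lemma count_in_ext y y' u v N : (forall n, y n = y' n) ->
  count_in y u v N = count_in y' u v N.
Proof. intros H; induction N; simpl; auto. rewrite IHN, H; auto. Qed.

Theorem mainTheorem6 (x : R) :
  0 <= x <= 1 -> schnorr_random x -> strongly_UD_random x.
Proof.
  intros Hx Hrand w (f & Hf & Hw) (k & Hk & Hsep) u v Hu Huv Hv eps Heps.
  set (y := fun n => Q2R (Q_of_code (f n)) * x).
  assert (Hsep' : separated k (fun i => Q2R (Q_of_code (f i)))).
  { intros i j Hij. rewrite <- !Hw. auto. }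
  destruct (schnorr_interval_bound x f k 0 u (eps / 4)) as [N1 H1]; auto; try lra.
  destruct (schnorr_interval_bound x f k u v (eps / 4)) as [N2 H2]; auto; try lra.
  destruct (schnorr_interval_bound x f k v 1 (eps / 4)) as [N3 H3]; auto; try lra.
  fold y in H1, H2, H3.
  exists (S (N1 + N2 + N3)). intros N HN. unfold R_dist.
  rewrite (count_in_ext _ y) by (intros n; unfold y; rewrite Hw; auto).
  specialize (H1 N ltac:(lia)). specialize (H2 N ltac:(lia)). specialize (H3 N ltac:(lia)).
  pose proof (count_in_cover y u v N Hu Hv) as Hc. apply le_INR in Hc.
  rewrite !plus_INR in Hc.
  assert (HN' : 0 < INR N) by (apply lt_0_INR; lia).
  set (c := INR (count_in y u v N)) in *.
  assert (Ec : c = c / INR N * INR N) by (field; lra).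
  set (q := c / INR N) in *.
  apply Rle_lt_trans with (3 * (eps / 4)); [|lra].
  apply Rabs_le; split; apply Rmult_le_reg_r with (INR N); auto; nra.
Qed.
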